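(* Let $K$ be a field of characteristic $p>0$ and $S=K[x_1,\ldots,x_n]$. Let $f\in S$ be a square-free supported polynomial with irreducible factors $f_1,\ldots,f_t$. Then the ring $S/(f_1,\ldots,f_t)$ is F-rational.
   Context: A polynomial $f\in S=K[x_1,\ldots,x_n]$ is square-free supported if every monomial appearing in $f$ with non-zero coefficient is square-free (equivalently, $f$ has degree at most one in each variable). Saying that $f$ has irreducible factors $f_1,\ldots,f_t$ means $f=f_1\cdots f_t$ with every $f_i$ irreducible in $S$. A Noetherian ring $R$ of prime characteristic $p$ is F-rational if every parameter ideal of $R$ is tightly closed. An ideal $I=(r_1,\ldots,r_m)$ of $R$ is a parameter ideal if for every prime ideal $\mathfrak p\supseteq I$ the images of $r_1,\ldots,r_m$ in $R_{\mathfrak p}$ form part of a system of parameters of $R_{\mathfrak p}$. An ideal $I$ is tightly closed if $I=I^*$, where $I^*$ is the set of $r\in R$ for which there is $c\in R$ not in any minimal prime of $R$ with $cr^{p^e}\in I^{[p^e]}$ for all $e\gg 0$; here $I^{[p^e]}$ is the ideal generated by the $p^e$-th powers of elements of $I$. *)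

(* Defs.v *)
From HB Require Import structures.
From mathcomp Require Import all_boot all_algebra generic_quotient ring.
From mathcomp Require Import boolp classical_sets mpoly.

Set Implicit Arguments.
Unset Strict Implicit.
Unset Printing Implicit Defensive.

Import GRing.Theory.
Local Open Scope ring_scope.
Local Open Scope quotient_scope.
Local Open Scope classical_set_scope.

(* All rings below are comPzRingType: the zero ring and improper ideals are
   allowed, which the library's idealr and {ideal_quot _} exclude. *)

(* Lets an ideal be applied to an element, through the coercion to set. *)
Identity Coercion fun_of_set : set >-> Funclass.

Definition is_ideal (R : comPzRingType) (I : set R) : Prop :=
  [/\ I 0, forall x y, I x -> I y -> I (x + y) & forall a x, I x -> I (a * x)].

Record ideal (R : comPzRingType) := Ideal {
  ideal_set :> set R;
  idealP : is_ideal ideal_set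
}.

Section Ideals.
Variable R : comPzRingType.
Implicit Types (I J P M : ideal R) (X : set R).

Definition ideal_gen_set X : set R :=
  [set x | forall J : ideal R, X `<=` J -> J x].

Lemma ideal_gen_is_ideal X : is_ideal (ideal_gen_set X).
Proof.
split=> [J _|x y hx hy J XJ|a x hx J XJ]; case: (idealP J) => J0 JD JM //.
  by apply: JD; [exact: hx|exact: hy].
by apply: JM; exact: hx.
Qed.

Definition ideal_gen X : ideal R := Ideal (ideal_gen_is_ideal X).

Definition ideal_span (rs : seq R) : ideal R := ideal_gen [set x | x \in rs].

Definition prime_ideal P : Prop :=
  ~ P 1 /\ forall x y, P (x * y) -> P x \/ P y.

Definition minimal_prime P : Prop :=
  prime_ideal P /\ forall Q : ideal R, prime_ideal Q -> Q `<=` P -> P `<=` Q.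

Definition maximal_ideal M : Prop :=
  ~ M 1 /\ forall J : ideal R, M `<=` J -> J 1 \/ J `<=` M.

Definition radical I : set R := [set x | exists k : nat, I (x ^+ k)].

Definition noetherian : Prop :=
  forall I, exists rs : seq R, I = ideal_span rs :> set R.

Definition has_prime_char (p : nat) : Prop :=
  [/\ (1 : R) <> 0, prime p & p%:R = 0 :> R].

Definition prime_chain (d : nat) (p : nat -> ideal R) : Prop :=
  (forall i, (i <= d)%N -> prime_ideal (p i)) /\
  (forall i, (i < d)%N -> p i `<` p i.+1).

Definition has_krull_dim (d : nat) : Prop :=
  (exists p, prime_chain d p) /\
  (forall e p, prime_chain e p -> (e <= d)%N).

Definition local_ring_with M : Prop :=
  maximal_ideal M /\
  forall N : ideal R, maximal_ideal N -> N = M :> set R.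

Definition system_of_parameters (xs : seq R) : Prop :=
  exists2 M : ideal R, local_ring_with M &
    has_krull_dim (size xs) /\ radical (ideal_span xs) = M.

Definition part_of_system_of_parameters (xs : seq R) : Prop :=
  exists ys : seq R, system_of_parameters (xs ++ ys).

End Ideals.

Section IdealPredicate.
Variables (R : comPzRingType) (I : ideal R).

Definition ideal_pred : {pred R} := fun x => `[< I x >].

Lemma ideal_pred_zmod_closed : zmod_closed ideal_pred.
Proof.
case: (idealP I) => I0 ID IM; split=> [|x y /asboolP hx /asboolP hy].
  exact/asboolP.
by apply/asboolP/ID => //; rewrite -mulN1r; exact: IM.
Qed.

HB.instance Definition _ :=
  GRing.isZmodClosed.Build R ideal_pred ideal_pred_zmod_closed.

Lemma ideal_predM a x : x \in ideal_pred -> a * x \in ideal_pred.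
Proof. by case: (idealP I) => _ _ IM /asboolP hx; apply/asboolP/IM. Qed.

End IdealPredicate.

(* R / I: the library's additive quotient, equipped with its multiplication. *)
Section QuotientRing.
Variables (R : comPzRingType) (I : ideal R).

Definition quot_ring : Type := Quotient.quot (ideal_pred I).

HB.instance Definition _ : EqQuotient R (Quotient.equiv (ideal_pred I))
  quot_ring := EqQuotient.on quot_ring.
HB.instance Definition _ := GRing.Zmodule.on quot_ring.

Definition to_quot (x : R) : quot_ring := \pi_quot_ring x.
Let mulq (x y : quot_ring) : quot_ring := to_quot (repr x * repr y).

Let to_quotW (Q : quot_ring -> Prop) : (forall x, Q (to_quot x)) ->
  forall x, Q x.
Proof. by move=> h x; rewrite -[x]reprK; exact: h. Qed.

Lemma to_quot_eq x y : to_quot x = to_quot y <-> I (x - y).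
Proof.
split=> [/eqmodP|h]; first by move=> /asboolP.
by apply/eqmodP; exact/asboolP.
Qed.

Let to_quotD : {morph to_quot : x y / x + y}.
Proof. exact: Quotient.pi_add. Qed.

Let to_quotM : {morph to_quot : x y / x * y >-> mulq x y}.
Proof.
move=> x y; apply/to_quot_eq.
have [hx hy] : I (x - repr (to_quot x)) /\ I (y - repr (to_quot y)).
  by split; apply/to_quot_eq; rewrite /to_quot reprK.
case: (idealP I) => _ ID IM.
have -> : x * y - repr (to_quot x) * repr (to_quot y) =
  y * (x - repr (to_quot x)) + repr (to_quot x) * (y - repr (to_quot y)).
  by ring.
by apply: ID; exact: IM.
Qed.

Let mulqA : associative mulq.
Proof.
by elim/to_quotW=> x; elim/to_quotW=> y; elim/to_quotW=> z;
   rewrite -!to_quotM mulrA.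
Qed.

Let mulqC : commutative mulq.
Proof. by elim/to_quotW=> x; elim/to_quotW=> y; rewrite -!to_quotM mulrC. Qed.

Let mul1q : left_id (to_quot 1) mulq.
Proof. by elim/to_quotW=> x; rewrite -to_quotM mul1r. Qed.

Let mulqDl : left_distributive mulq +%R.
Proof.
elim/to_quotW=> x; elim/to_quotW=> y; elim/to_quotW=> z.
by rewrite -to_quotD -!to_quotM -to_quotD mulrDl.
Qed.

HB.instance Definition _ := GRing.Zmodule_isComPzRing.Build quot_ring
  mulqA mulqC mul1q mulqDl.

Lemma to_quot_zmod_morphism : zmod_morphism to_quot.
Proof. exact: pi_is_zmod_morphism. Qed.

Lemma to_quot_monoid_morphism : monoid_morphism to_quot.
Proof. by split=> // x y; exact: to_quotM. Qed.

HB.instance Definition _ :=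
  GRing.isZmodMorphism.Build R quot_ring to_quot to_quot_zmod_morphism.
HB.instance Definition _ :=
  GRing.isMonoidMorphism.Build R quot_ring to_quot to_quot_monoid_morphism.

End QuotientRing.

(* The factor u in loc_equiv is needed because R may have zero divisors. *)
Section Localization.
Variables (R : comPzRingType) (P : ideal R) (primeP : prime_ideal P).

Definition denominator := {s : R | s \notin ideal_pred P}.
Implicit Types (a b c : R) (s t u : denominator).

Let den_subproof1 : (1 : R) \notin ideal_pred P.
Proof. by apply/asboolP; case: primeP. Qed.
Definition den1 : denominator := exist _ 1 den_subproof1.

Let den_subproofM s t : sval s * sval t \notin ideal_pred P.
Proof.
apply/asboolP => /primeP.2.
by case=> h; [move: (valP s)|move: (valP t)] => /asboolP.
Qed.
Definition denM s t : denominator :=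
  exist _ (sval s * sval t) (den_subproofM s t).

Definition loc_equiv (x y : R * denominator) : bool :=
  `[< exists u, sval u * (x.1 * sval y.2) = sval u * (y.1 * sval x.2) >].

Let loc_equiv_refl : reflexive loc_equiv.
Proof. by move=> x; apply/asboolP; exists den1. Qed.

Let loc_equiv_sym : ssrbool.symmetric loc_equiv.
Proof.
by move=> x y; apply/asboolP/asboolP => -[u h]; exists u.
Qed.

Let loc_equiv_trans : transitive loc_equiv.
Proof.
move=> [b t] [a s] [c r] /asboolP[u /= h] /asboolP[v /= k]; apply/asboolP.
exists (denM (denM u v) t) => /=.
transitivity (sval v * sval r * (sval u * (a * sval t))); first by ring.
rewrite h; transitivity (sval u * sval s * (sval v * (b * sval r))); first by ring.
by rewrite k; ring.
Qed.

Canonical loc_equiv_rel :=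
  EquivRel loc_equiv loc_equiv_refl loc_equiv_sym loc_equiv_trans.

Definition localization : Type := {eq_quot loc_equiv}.

HB.instance Definition _ : EqQuotient _ loc_equiv localization :=
  EqQuotient.on localization.
HB.instance Definition _ := Choice.on localization.

Definition mk_frac a s : localization := \pi_localization (a, s).

Lemma mk_frac_eq a s b t : mk_frac a s = mk_frac b t <->
  exists u, sval u * (a * sval t) = sval u * (b * sval s).
Proof.
split=> [/eqmodP|h]; first by move=> /asboolP.
by apply/eqmodP; exact/asboolP.
Qed.

Lemma mk_fracW (Q : localization -> Prop) :
  (forall a s, Q (mk_frac a s)) -> forall x, Q x.
Proof.
by move=> h x; rewrite -[x]reprK; case: (repr x) => a s; exact: h.
Qed.

Let num (x : localization) : R := (repr x).1.
Let den (x : localization) : denominator := (repr x).2.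

Let num_den a s : exists u,
  sval u * (a * sval (den (mk_frac a s))) = sval u * (num (mk_frac a s) * sval s).
Proof.
apply/mk_frac_eq; rewrite /num /den {2}/mk_frac -surjective_pairing.
by rewrite reprK.
Qed.

Let addl (x y : localization) : localization :=
  mk_frac (num x * sval (den y) + num y * sval (den x)) (denM (den x) (den y)).
Let oppl (x : localization) : localization := mk_frac (- num x) (den x).
Let mull (x y : localization) : localization :=
  mk_frac (num x * num y) (denM (den x) (den y)).

Let addlE a s b t :
  addl (mk_frac a s) (mk_frac b t) =
  mk_frac (a * sval t + b * sval s) (denM s t).
Proof.
apply/mk_frac_eq => /=; have [u hu] := num_den a s; have [v hv] := num_den b t.
move: hu hv; set a' := num _; set s' := den _; set b' := num _; set t' := den _.
move=> hu hv; exists (denM u v) => /=.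
transitivity (sval v * sval t * sval t' * (sval u * (a' * sval s)) +
              sval u * sval s * sval s' * (sval v * (b' * sval t))); first by ring.
by rewrite -hu -hv; ring.
Qed.

Let opplE a s : oppl (mk_frac a s) = mk_frac (- a) s.
Proof.
apply/mk_frac_eq; have [u hu] := num_den a s.
by exists u; rewrite !mulNr !mulrN hu.
Qed.

Let mullE a s b t :
  mull (mk_frac a s) (mk_frac b t) = mk_frac (a * b) (denM s t).
Proof.
apply/mk_frac_eq => /=; have [u hu] := num_den a s; have [v hv] := num_den b t.
move: hu hv; set a' := num _; set s' := den _; set b' := num _; set t' := den _.
move=> hu hv; exists (denM u v) => /=.
transitivity (sval u * (a' * sval s) * (sval v * (b' * sval t))); first by ring.
by rewrite -hu -hv; ring.
Qed.

Let addlA : associative addl.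
Proof.
elim/mk_fracW=> a s; elim/mk_fracW=> b t; elim/mk_fracW=> c u.
by rewrite !addlE; apply/mk_frac_eq; exists den1 => /=; ring.
Qed.

Let addlC : commutative addl.
Proof.
elim/mk_fracW=> a s; elim/mk_fracW=> b t.
by rewrite !addlE; apply/mk_frac_eq; exists den1 => /=; ring.
Qed.

Let add0l : left_id (mk_frac 0 den1) addl.
Proof.
elim/mk_fracW=> a s.
by rewrite addlE; apply/mk_frac_eq; exists den1 => /=; ring.
Qed.

Let addNl : left_inverse (mk_frac 0 den1) oppl addl.
Proof.
elim/mk_fracW=> a s.
by rewrite opplE addlE; apply/mk_frac_eq; exists den1 => /=; ring.
Qed.

HB.instance Definition _ :=
  GRing.isZmodule.Build localization addlA addlC add0l addNl.

Let mullA : associative mull.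
Proof.
elim/mk_fracW=> a s; elim/mk_fracW=> b t; elim/mk_fracW=> c u.
by rewrite !mullE; apply/mk_frac_eq; exists den1 => /=; ring.
Qed.

Let mullC : commutative mull.
Proof.
elim/mk_fracW=> a s; elim/mk_fracW=> b t.
by rewrite !mullE; apply/mk_frac_eq; exists den1 => /=; ring.
Qed.

Let mul1l : left_id (mk_frac 1 den1) mull.
Proof.
elim/mk_fracW=> a s.
by rewrite mullE; apply/mk_frac_eq; exists den1 => /=; ring.
Qed.

Let mullDl : left_distributive mull +%R.
Proof.
elim/mk_fracW=> a s; elim/mk_fracW=> b t; elim/mk_fracW=> c u.
rewrite -[_ + _ in LHS]/(addl _ _) -[_ + _ in RHS]/(addl _ _).
by rewrite !(addlE, mullE); apply/mk_frac_eq; exists den1 => /=; ring.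
Qed.

HB.instance Definition _ := GRing.Zmodule_isComPzRing.Build localization
  mullA mullC mul1l mullDl.

Lemma mk_fracD a s b t : mk_frac a s + mk_frac b t =
  mk_frac (a * sval t + b * sval s) (denM s t).
Proof. exact: addlE. Qed.

Lemma mk_fracN a s : - mk_frac a s = mk_frac (- a) s.
Proof. exact: opplE. Qed.

Lemma mk_fracM a s b t :
  mk_frac a s * mk_frac b t = mk_frac (a * b) (denM s t).
Proof. exact: mullE. Qed.

Definition to_loc a : localization := mk_frac a den1.

Lemma to_loc_zmod_morphism : zmod_morphism to_loc.
Proof.
move=> a b; rewrite /to_loc mk_fracN mk_fracD.
by apply/mk_frac_eq; exists den1 => /=; ring.
Qed.

Lemma to_loc_monoid_morphism : monoid_morphism to_loc.
Proof.
split=> // a b; rewrite /to_loc mk_fracM.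
by apply/mk_frac_eq; exists den1 => /=; ring.
Qed.

HB.instance Definition _ :=
  GRing.isZmodMorphism.Build R localization to_loc to_loc_zmod_morphism.
HB.instance Definition _ :=
  GRing.isMonoidMorphism.Build R localization to_loc to_loc_monoid_morphism.

End Localization.

Section FRationality.
Variable R : comPzRingType.
Implicit Types I : ideal R.

Definition parameter_ideal I : Prop :=
  exists rs : seq R, I = ideal_span rs :> set R /\
    forall (P : ideal R) (primeP : prime_ideal P), I `<=` P ->
      part_of_system_of_parameters [seq to_loc primeP r | r <- rs].

Definition frobenius_power (p e : nat) I : ideal R :=
  ideal_gen [set x ^+ (p ^ e) | x in I].

Definition tight_closure (p : nat) I : set R :=
  [set r | exists2 c : R, (forall P, minimal_prime P -> ~ P c) &
    exists e0 : nat, forall e, (e0 <= e)%N ->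
      frobenius_power p e I (c * r ^+ (p ^ e))].

Definition tightly_closed (p : nat) I : Prop := tight_closure p I = I.

Definition F_rational (p : nat) : Prop :=
  [/\ noetherian R, has_prime_char R p &
      forall I, parameter_ideal I -> tightly_closed p I].

End FRationality.

Definition irreducible_element (R : unitRingType) (a : R) : Prop :=
  [/\ a != 0, a \isn't a GRing.unit &
      forall b c, a = b * c ->
        b \is a GRing.unit \/ c \is a GRing.unit].

Definition square_free_supported (K : fieldType) (n : nat)
    (f : {mpoly K[n]}) : Prop :=
  forall m : 'X_{1..n}, m \in msupp f -> forall i : 'I_n, (m i <= 1)%N.

(* Main.v *)
From HB Require Import structures.
Require Import Defs.
From mathcomp Require Import all_boot all_algebra.
From mathcomp Require Import boolp classical_sets mpoly.
From mathcomp Require Import order ring zify.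

Set Implicit Arguments.
Unset Strict Implicit.
Unset Printing Implicit Defensive.

Import GRing.Theory.
Local Open Scope ring_scope.

(** The factors [f_1, ..., f_t] of [f] have degree at most one in each variable
    and pairwise disjoint sets of variables. The proof shows that the quotient
    by [J = (f_1, ..., f_t)] is a domain in which every ideal is tightly closed,
    following the Fedder and Glassbrenner criteria for strong F-regularity, with
    compatible ideals in the place of test elements.

    Fix a splitting [lam] of the Frobenius of [K], and let [T : S -> S] send
    [c x ^ (p m + (p - 1))] to [lam c x ^ m] and the other monomials to [0]. Then
    [T (u ^ p v) = u T v], so [T] takes [I ^ [p q]] into [I ^ [q]]. If [d r ^ q]
    lies in [I ^ [q] + J] for all large [q], where [I] contains [J], then
    [d f ^ (q - 1) r ^ q] lies in [I ^ [q]]. The multipliers [d] of this kind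
    form an ideal stable under [c |-> T (f ^ (p - 1) c)]. The exponents of
    [f ^ (p - 1)] are at most [p - 1], so some [w] has [T (w f ^ (p - 1)) = 1]
    ([trace_splits]); hence the ideal is proper unless [r] is in [I]. A maximal
    proper stable ideal is prime ([stable_prime]).

    The heart is [compatible_prime]: a stable prime [P] is generated by those
    [f_i] that it contains. So if [r] is not in [I], every multiplier [d] lies in
    [J], that is, in the minimal prime of the quotient, and [r] is not in the
    tight closure of [I]. The proof is by induction on the number of variables. Write [f_i = g z + h] for
    an [f_i] in [P]. The expansion of [f_i ^ (p - 1)] in powers of [z] shows that
    the [z]-free part of [P] is stable for the two products in which [f_i] is
    replaced by [g] or by [h] ([compatible_slope], [compatible_const]), which
    are again of degree at most one in each variable.

    What makes this work is how rigid families of irreducible polynomials with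
    disjoint variables are: the ideal of a family is prime ([family_prime]), and
    each of its nonzero elements uses all the variables of some member
    ([span_vars]). *)

(** * Ideals *)

Section IdealTheory.
Variable R : comPzRingType.
Implicit Types (I J P : ideal R) (rs : seq R) (x y a c : R).

Lemma ideal0 I : I 0. Proof. by case: (idealP I). Qed.

Lemma idealD I x y : I x -> I y -> I (x + y).
Proof. by case: (idealP I) => _ h _; exact: h. Qed.

Lemma ideal_mull I a x : I x -> I (a * x).
Proof. by case: (idealP I) => _ _ h; exact: h. Qed.

Lemma ideal_mulr I a x : I x -> I (x * a).
Proof. by rewrite mulrC; exact: ideal_mull. Qed.

Lemma idealN I x : I x -> I (- x).
Proof. by rewrite -mulN1r; exact: ideal_mull. Qed.

Lemma idealB I x y : I x -> I y -> I (x - y).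
Proof. by move=> hx hy; apply: idealD => //; exact: idealN. Qed.

Lemma ideal_subl I x y : I (x - y) -> I y -> I x.
Proof. by move=> h hy; rewrite -[x](subrK y); exact: idealD. Qed.

Lemma ideal_sum I (T : Type) (r : seq T) (Q : pred T) (F : T -> R) :
  (forall t, Q t -> I (F t)) -> I (\sum_(t <- r | Q t) F t).
Proof. by move=> h; elim/big_ind: _ => //; [exact: ideal0|exact: idealD]. Qed.

Lemma ideal_span_mem rs a : a \in rs -> ideal_span rs a.
Proof. by move=> h J; exact. Qed.

Lemma ideal_span_sub rs J : (forall a, a \in rs -> J a) ->
  forall x, ideal_span rs x -> J x.
Proof. by move=> h x; apply. Qed.

Lemma ideal_span_mono rs rs' : {subset rs <= rs'} ->
  forall x, ideal_span rs x -> ideal_span rs' x.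
Proof. by move=> h; apply: ideal_span_sub => a /h; exact: ideal_span_mem. Qed.

Lemma zero_is_ideal : is_ideal (fun x : R => x = 0).
Proof. by split=> // [x y -> ->|a x ->]; rewrite ?addr0 ?mulr0. Qed.

Definition zero_ideal : ideal R := Ideal zero_is_ideal.

Lemma zero_minimal_prime : prime_ideal zero_ideal -> minimal_prime zero_ideal.
Proof. by move=> prZ; split=> // Q _ _ x ->; exact: ideal0. Qed.

Lemma ideal_span_nil x : ideal_span [::] x -> x = 0.
Proof. exact: (ideal_span_sub (J := zero_ideal)). Qed.

Lemma ideal_span_cons a rs x : ideal_span (a :: rs) x ->
  exists w, ideal_span rs (x - w * a).
Proof.
have z : is_ideal [set y | exists w, ideal_span rs (y - w * a)].
  split=> /= [|y z [w hw] [v hv]|b y [w hw]].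
  - by exists 0; rewrite mul0r subr0; exact: (ideal0 (ideal_span rs)).
  - exists (w + v); rewrite mulrDl opprD addrACA.
    exact: (idealD (I := ideal_span rs)).
  - by exists (b * w); rewrite -mulrA -mulrBr; exact: (ideal_mull (I := ideal_span rs)).
apply: (ideal_span_sub (J := Ideal z)) => b /=; rewrite inE => /orP[/eqP->|hb].
  by exists 1; rewrite mul1r subrr; exact: (ideal0 (ideal_span rs)).
by exists 0; rewrite mul0r subr0; exact: ideal_span_mem.
Qed.

Lemma ideal_span_tail a rs x : ideal_span rs x -> ideal_span (a :: rs) x.
Proof. by apply: ideal_span_mono => b hb; rewrite inE hb orbT. Qed.

Lemma ideal_span_head a rs w : ideal_span (a :: rs) (w * a).
Proof. by apply: ideal_mull; apply: ideal_span_mem; rewrite inE eqxx. Qed.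

Lemma colon_is_ideal I c : is_ideal [set x | I (x * c)].
Proof.
split=> /= [|x y hx hy|a x hx]; first by rewrite mul0r; exact: ideal0.
  by rewrite mulrDl; exact: idealD.
by rewrite -mulrA; exact: ideal_mull.
Qed.

Definition colon I c : ideal R := Ideal (colon_is_ideal I c).

Lemma prime_exp P x k : prime_ideal P -> P (x ^+ k) -> P x.
Proof.
move=> [P1 PM]; elim: k => [|k IH]; first by rewrite expr0.
by rewrite exprS => /PM[].
Qed.

Lemma prime_prod P rs : prime_ideal P -> P (\prod_(a <- rs) a) ->
  exists2 a, a \in rs & P a.
Proof.
move=> [P1 PM]; elim: rs => [|a rs IH]; first by rewrite big_nil.
rewrite big_cons => /PM[ha|/IH[b hb Pb]].
  by exists a => //; rewrite inE eqxx.
by exists b => //; rewrite inE hb orbT.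
Qed.

End IdealTheory.

Lemma preim_is_ideal (R R' : comPzRingType) (phi : {rmorphism R -> R'})
  (A : ideal R') : is_ideal [set x | A (phi x)].
Proof.
split=> /= [|x y hx hy|a x hx]; first by rewrite rmorph0; exact: ideal0.
  by rewrite rmorphD; exact: idealD.
by rewrite rmorphM; exact: ideal_mull.
Qed.

Definition preim_ideal (R R' : comPzRingType) (phi : {rmorphism R -> R'})
  (A : ideal R') : ideal R := Ideal (preim_is_ideal phi A).

Lemma preim_prime (R R' : comPzRingType) (phi : {rmorphism R -> R'})
  (P : ideal R') : prime_ideal P -> prime_ideal (preim_ideal phi P).
Proof.
by move=> [P1 PM]; split=> /= [|x y]; rewrite ?rmorph1 ?rmorphM //; exact: PM.
Qed.

(** ** Extension of ideals to polynomials *)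

Section PolyIdeal.
Variable R : comNzRingType.
Implicit Types (A P : ideal R) (p q : {poly R}).

Lemma poly_is_ideal A : is_ideal [set q : {poly R} | forall k, A (q`_k)].
Proof.
split=> [k|p q hp hq k|p q hq k] /=.
- by rewrite coef0; exact: ideal0.
- by rewrite coefD; exact: idealD.
- by rewrite coefM; apply: ideal_sum => l _; exact: ideal_mull.
Qed.

Definition poly_ideal A : ideal {poly R} := Ideal (poly_is_ideal A).

Lemma poly_idealC A c : poly_ideal A c%:P <-> A c.
Proof.
split=> [/(_ 0%N)|hc k]; first by rewrite coefC.
by rewrite coefC; case: ifP => // _; exact: ideal0.
Qed.

(** The product of two polynomials outside [P] has a coefficient outside [P],
    in the degree that is the sum of their lowest such degrees. *)
Lemma poly_ideal_prime P : prime_ideal P -> prime_ideal (poly_ideal P).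
Proof.
move=> [P1 PM]; split=> [|u v huv]; first by rewrite -polyC1 => /poly_idealC.
apply: contrapT => /not_orP[hu hv].
have low w : ~ poly_ideal P w -> exists k, ~ P (w`_k) /\
    forall l, (l < k)%N -> P (w`_l).
  move=> hw; have ex : exists k, asbool (~ P (w`_k)).
    apply: contrapT => h; apply: hw => k; apply: contrapT => hk.
    by apply: h; exists k; apply/asboolP.
  case: (ex_minnP ex) => k /asboolP hk mink; exists k; split=> // l lk.
  apply: contrapT => hl; have := mink l; rewrite leqNgt lk => h.
  by have : false by apply: h; apply/asboolP.
have [k [uk ul]] := low u hu; have [l [vl vlt]] := low v hv.
have := huv (k + l)%N; rewrite coefM.
have kl : (k < (k + l).+1)%N by rewrite ltnS leq_addr.
rewrite (bigD1 (Ordinal kl)) //= addKn => h.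
have {h} /PM[] // : P (u`_k * v`_l).
rewrite -[X in P X](addrK (\sum_(j < (k + l).+1 | j != Ordinal kl)
  u`_j * v`_(k + l - j))).
apply: idealB => //; apply: ideal_sum => j jk.
have [jl|jg|je] := ltngtP j k; first by apply: ideal_mulr; exact: ul.
  by apply: ideal_mull; apply: vlt; have := ltn_ord j; lia.
by case/eqP: jk; apply: val_inj.
Qed.

Definition phi_coef_ideal (phi : {rmorphism R -> {poly R}}) A : ideal R :=
  preim_ideal phi (poly_ideal A).

Lemma phi_coef_ideal_prime (phi : {rmorphism R -> {poly R}}) P :
  prime_ideal P -> prime_ideal (phi_coef_ideal phi P).
Proof. by move=> /poly_ideal_prime; exact: preim_prime. Qed.

End PolyIdeal.

(** Substituting [- h / g] for the variable, with the denominators cleared: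
    going down from the top coefficient of [p], each coefficient of
    [u - p * (g X + h)] expresses [p`_k g] through [p`_k.+1]. *)
Lemma eliminate_affine (R : comNzRingType) (A : ideal R) (p : {poly R})
    (g h u : R) :
  (forall k, A (u%:P - p * (g%:P * 'X + h%:P))`_k) -> A (g ^+ size p * u).
Proof.
move=> co.
have c0 : A (u - p`_0 * h).
  have := co 0%N.
  by rewrite coefB coefC /= mulrDr mulrA coefD coefMX !coefMC /= add0r.
have cS k : A (p`_k * g + p`_k.+1 * h).
  have := co k.+1; rewrite coefB coefC /= mulrDr mulrA coefD coefMX !coefMC /=.
  by rewrite sub0r => /idealN; rewrite opprK.
have down k : A (g ^+ k * p`_(size p - k)).
  elim: k => [|k IH]; first by rewrite subn0 nth_default // mulr0; exact: ideal0.
  have [lt|ge] := ltnP k (size p); last first.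
    have e : (size p - k.+1 = size p - k)%N by lia.
    by rewrite e exprS -mulrA; exact: ideal_mull.
  have := cS (size p - k.+1)%N; have -> : (size p - k.+1).+1 = (size p - k)%N by lia.
  move=> /(ideal_mull (g ^+ k)); rewrite mulrDr [g ^+ k * (_ * h)]mulrA => h1.
  rewrite exprSr -mulrA [g * _]mulrC -[X in A X](addrK (g ^+ k * p`_(size p - k) * h)).
  by apply: idealB => //; exact: ideal_mulr.
have := down (size p); rewrite subnn => hd.
rewrite -[u](subrK (p`_0 * h)) mulrDr mulrA; apply: idealD; first exact: ideal_mull.
exact: ideal_mulr.
Qed.

(** ** Identities in a commutative ring *)

Section RingIdentities.
Variable R : comPzRingType.
Implicit Types (a b c d g r s u v w x : R).

Lemma cross_elim a b c d x : a * (b * x + c) - b * (a * x + d) = a * c - b * d.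
Proof. ring. Qed.

Lemma pseudo_add a g r s u v w x N M :
  g ^+ N * u = r + w * a -> g ^+ M * v = s + x * a ->
  g ^+ (N + M) * (u + v) = (g ^+ M * r + g ^+ N * s) + (g ^+ M * w + g ^+ N * x) * a.
Proof.
move=> e e'; transitivity (g ^+ M * (g ^+ N * u) + g ^+ N * (g ^+ M * v)).
  by rewrite exprD; ring.
by rewrite e e'; ring.
Qed.

Lemma pseudo_mul a g r s u v w x N M :
  g ^+ N * u = r + w * a -> g ^+ M * v = s + x * a ->
  g ^+ (N + M) * (u * v) = r * s + (w * (s + x * a) + r * x) * a.
Proof.
move=> e e'; transitivity (g ^+ N * u * (g ^+ M * v)); first by rewrite exprD; ring.
by rewrite e e'; ring.
Qed.

Lemma pseudo_var a g h x : a = g * x + h -> g ^+ 1 * x = - h + 1 * a.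
Proof. by move=> ->; ring. Qed.

Lemma pseudo_free a g u : g ^+ 0 * u = u + 0 * a.
Proof. ring. Qed.

Lemma pseudo_swap a b u w x : b * (u - x * a) - (w - x * b) * a = b * u - w * a.
Proof. ring. Qed.

Lemma mulr_extract a b c d : a * (b * (c * d)) = c * (a * b * d).
Proof. ring. Qed.

Lemma mulr_rotl a b c : a * b * c = b * c * a.
Proof. ring. Qed.

Lemma mulr_rotr a b c : a * b * c = c * a * b.
Proof. ring. Qed.

Lemma mulr_extract_rot a b c d : a * b * (c * d) = c * (b * d * a).
Proof. ring. Qed.

Lemma factor_affine b c d x : (c * b) * x + d * b = b * (c * x + d).
Proof. ring. Qed.

End RingIdentities.

Lemma affine_pow_top (R : comNzRingType) (g h v x : R) q :
  v * (g * x + h) ^+ q = (v * g ^+ q) * x ^+ q +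
    \sum_(j < q) (v * g ^+ (q - j.+1) * h ^+ j.+1 *+ 'C(q, j.+1)) * x ^+ (q - j.+1).
Proof.
rewrite exprDn big_ord_recl /= bin0 mulr1n subn0 expr0 mulr1 exprMn mulrDr mulrA.
congr (_ + _); rewrite mulr_sumr; apply: eq_bigr => j _.
rewrite /bump /= add1n exprMn !mulrnAr !mulrnAl; congr (_ *+ _).
by rewrite -!mulrA; congr (_ * (_ * _)); rewrite mulrC.
Qed.

Lemma affine_pow_bottom (R : comNzRingType) (g h v x : R) q :
  x ^+ q * (v * (g * x + h) ^+ q) = (v * h ^+ q) * x ^+ q +
    \sum_(j < q) x ^+ q.+1 * ((v * g ^+ j.+1 * h ^+ (q - j.+1) *+ 'C(q, j.+1)) * x ^+ j).
Proof.
rewrite [_ + h]addrC exprDn big_ord_recl /= bin0 mulr1n subn0 expr0 mulr1 !mulrDr.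
congr (_ + _); first by rewrite mulrC.
rewrite !mulr_sumr; apply: eq_bigr => j _.
rewrite /bump /= add1n exprMn [x ^+ j.+1]exprS !mulrnAr !mulrnAl !mulrnAr.
congr (_ *+ _); rewrite [x ^+ q.+1]exprSr.
by move: (h ^+ _) (g ^+ _) (x ^+ q) (x ^+ j) => H G X Y; ring.
Qed.

(** * Separating one variable *)

Lemma poly_affine (R : nzRingType) (q : {poly R}) :
  (size q <= 2)%N -> q = (q`_1)%:P * 'X + (q`_0)%:P.
Proof.
move=> h; apply/polyP => k; rewrite coefD coefMX !coefC.
case: k => [|[|k]] /=; rewrite ?add0r ?addr0 //.
by move/leq_sizeP: h => ->.
Qed.

Section OneVariable.
Variables (K : fieldType) (n : nat).
Notation S := {mpoly K[n]}.
Implicit Types (u v f g h : S) (i j : 'I_n) (m : 'X_{1..n}).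

(** The isomorphism of [S] with the polynomials in the [i]-th variable over
    the other variables, followed by the inclusion into [{poly S}]: the
    coefficients are kept in [S], so that inductions on the number of
    variables never change the ring. *)
Definition as_poly i : S -> {poly S} :=
  mmap (polyC \o @mpolyC n K) (fun j => if j == i then 'X else ('X_j)%:P).

HB.instance Definition _ i := GRing.RMorphism.on (as_poly i).

Lemma as_polyX i m :
  as_poly i 'X_[m] = ('X_[m - U_(i) *+ m i])%:P * 'X^(m i).
Proof.
rewrite /as_poly mmapX /mmap1 (bigD1 i) //= eqxx mulrC; congr (_ * _).
rewrite [in RHS]mpolyXE_id [in RHS](bigD1 i) //= mnmBE mulmnE mnm1E eqxx mul1n subnn expr0 mul1r.
rewrite rmorph_prod /=; apply: eq_bigr => j /negPf ji; rewrite ji rmorphXn /=.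
by rewrite mnmBE mulmnE mnm1E eq_sym ji mul0n subn0.
Qed.

Lemma as_polyZ i c u : as_poly i (c *: u) = c%:MP%:P * as_poly i u.
Proof. by rewrite /as_poly mmapZ. Qed.

Lemma as_polyC i c : as_poly i c%:MP = c%:MP%:P.
Proof. by rewrite /as_poly mmapC. Qed.

Opaque as_poly.

Lemma coef_as_poly i u k m :
  ((as_poly i u)`_k)@_m = if m i == 0%N then u@_(m + U_(i) *+ k) else 0.
Proof.
elim/mpolyind: u => [|c m' u _ _ IH].
  by rewrite rmorph0 coef0 !mcoeff0 if_same.
rewrite rmorphD /= coefD !mcoeffD [X in _ + X = _]IH as_polyZ as_polyX mulrA.
rewrite -polyCM coefMXn.
rewrite mcoeffZ mcoeffX.
suff -> : (if (k < m' i)%N then 0 else (c%:MP * 'X_[m' - U_(i) *+ m' i])%:P`_(k - m' i))@_m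
  = if m i == 0%N then c * (m' == (m + U_(i) *+ k)%MM)%:R else 0.
  by case: ifP => _ //; rewrite addr0.
rewrite coefC; case: (ltngtP k (m' i)) => [lt|gt|eqk].
- rewrite mcoeff0; case: ifP => // /eqP m0.
  case: eqP => [e|_]; last by rewrite mulr0.
  by move: lt; rewrite e mnmDE m0 mulmnE mnm1E eqxx add0n mul1n ltnn.
- rewrite subn_eq0 leqNgt gt /= mcoeff0; case: ifP => // /eqP m0.
  case: eqP => [e|_]; last by rewrite mulr0.
  by move: gt; rewrite e mnmDE m0 mulmnE mnm1E eqxx add0n mul1n ltnn.
- rewrite eqk subnn eqxx mcoeffCM mcoeffX; case: ifP => [/eqP m0|m0].
    congr (c * (nat_of_bool _)%:R); apply/eqP/eqP => [<-|e].
      apply/mnmP => j; rewrite mnmDE mnmBE !mulmnE mnm1E.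
      by case: eqP => [<-|_]; lia.
    apply/mnmP => j; rewrite mnmBE mulmnE.
    by have := congr1 (fun x : 'X_{1..n} => x j) e; rewrite mnmDE mulmnE; lia.
  case: eqP => [e|_]; last by rewrite mulr0.
  by move: m0; rewrite -e mnmBE mulmnE mnm1E eqxx mul1n subnn.
Qed.

Lemma as_polyK i u : (as_poly i u).['X_i] = u.
Proof.
elim/mpolyind: u => [|c m u _ _ IH]; first by rewrite rmorph0 horner0.
rewrite rmorphD /= hornerD [X in _ + X = _]IH as_polyZ as_polyX !(hornerM, hornerC, hornerXn) mpolyXn.
rewrite -mpolyXD mul_mpolyC; congr (_ *: 'X_[_] + _).
by apply/mnmP => j; rewrite mnmDE mnmBE !mulmnE mnm1E; case: eqP => [<-|_]; lia.
Qed.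

Lemma as_poly_inj i : injective (as_poly i).
Proof. by move=> u v e; rewrite -[u](as_polyK i) e as_polyK. Qed.

Lemma as_poly_eq0 i u : (as_poly i u == 0) = (u == 0).
Proof. by rewrite -(rmorph0 (as_poly i)) (inj_eq (@as_poly_inj i)). Qed.

(** One plus the degree in the [i]-th variable, and [0] for [u = 0]. *)
Definition vsize i u := size (as_poly i u).

Definition uses i u := (1 < vsize i u)%N.

Lemma vsize_gt0 i u : (0 < vsize i u)%N = (u != 0).
Proof. by rewrite size_poly_gt0 as_poly_eq0. Qed.

Lemma vsizeM i u v : u != 0 -> v != 0 ->
  vsize i (u * v) = (vsize i u + vsize i v).-1.
Proof. by move=> hu hv; rewrite /vsize rmorphM size_mul ?as_poly_eq0. Qed.

Lemma usesM i u v : u != 0 -> v != 0 -> uses i (u * v) = uses i u || uses i v.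
Proof.
move=> hu hv; rewrite /uses vsizeM //.
move: hu hv; rewrite -!(vsize_gt0 i); lia.
Qed.

Lemma unused_const i u : ~~ uses i u -> as_poly i u = u%:P.
Proof.
rewrite -leqNgt => /size1_polyC e.
by have := as_polyK i u; rewrite e hornerC => ->.
Qed.

Lemma const_unused i u v : as_poly i u = v%:P -> ~~ uses i u.
Proof. by rewrite /uses /vsize => ->; rewrite -leqNgt size_polyC leq_b1. Qed.

Lemma unusedD i u v : ~~ uses i u -> ~~ uses i v -> ~~ uses i (u + v).
Proof.
move=> /unused_const hu /unused_const hv.
by apply: (@const_unused _ _ (u + v)); rewrite rmorphD /= hu hv polyCD.
Qed.

Lemma unusedN i u : ~~ uses i u -> ~~ uses i (- u).
Proof.
move=> /unused_const hu.
by apply: (@const_unused _ _ (- u)); rewrite rmorphN /= hu polyCN.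
Qed.

Lemma unusedM i u v : ~~ uses i u -> ~~ uses i v -> ~~ uses i (u * v).
Proof.
move=> /unused_const hu /unused_const hv.
by apply: (@const_unused _ _ (u * v)); rewrite rmorphM /= hu hv polyCM.
Qed.

Lemma unusedC i c : ~~ uses i c%:MP.
Proof. by apply: (@const_unused _ _ c%:MP); rewrite as_polyC. Qed.

Lemma unusedX i u k : ~~ uses i u -> ~~ uses i (u ^+ k).
Proof.
move=> hu; elim: k => [|k IH]; first by rewrite expr0 -mpolyC1 unusedC.
by rewrite exprS unusedM.
Qed.

Lemma coef_unused i u k : ~~ uses i ((as_poly i u)`_k).
Proof.
rewrite -leqNgt; apply/leq_sizeP => l l1; apply/mpolyP => m.
rewrite coef_as_poly coef_as_poly mcoeff0; case: ifP => // _.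
rewrite mnmDE mulmnE mnm1E eqxx mul1n; case: eqP => // ?; lia.
Qed.

Lemma vsize_coef i j u k : (vsize j ((as_poly i u)`_k) <= vsize j u)%N.
Proof.
have [->|u0] := eqVneq u 0; first by rewrite rmorph0 coef0.
case: (eqVneq j i) => [->|ji].
  have := coef_unused i u k; rewrite -leqNgt => h; apply: leq_trans h _.
  by rewrite vsize_gt0.
apply/leq_sizeP => l hl; apply/mpolyP => m; rewrite mcoeff0.
rewrite coef_as_poly; case: ifP => // /eqP mj; rewrite coef_as_poly.
case: ifP => // /eqP mi; rewrite addmC addmA.
have /(congr1 (mcoeff (U_(i) *+ k + m)%MM)) := leq_sizeP _ _ hl l (leqnn l).
rewrite coef_as_poly mcoeff0 mnmDE mulmnE mnm1E [i == j]eq_sym (negPf ji) mj.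
by [].
Qed.

Lemma uses_coef i j u k : uses j ((as_poly i u)`_k) -> uses j u.
Proof. by move=> h; apply: leq_trans h (vsize_coef _ _ _ _). Qed.

Lemma unused_coef i j u k : ~~ uses j u -> ~~ uses j ((as_poly i u)`_k).
Proof. by apply: contra; exact: uses_coef. Qed.

Lemma msupp_vsize i u m : m \in msupp u -> (m i < vsize i u)%N.
Proof.
rewrite mcoeff_msupp ltnNge; apply: contra => /leq_sizeP/(_ _ (leqnn _)).
move=> /(congr1 (mcoeff (m - U_(i) *+ m i)%MM)).
rewrite coef_as_poly mcoeff0 mnmBE mulmnE mnm1E eqxx mul1n subnn eqxx.
suff -> : (m - U_(i) *+ m i + U_(i) *+ m i)%MM = m by move=> ->.
by apply/mnmP => j; rewrite mnmDE mnmBE !mulmnE mnm1E; case: eqP => [<-|_]; lia.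
Qed.

Lemma unused_msupp i u m : ~~ uses i u -> m \in msupp u -> m i = 0%N.
Proof. by rewrite /uses => h /(msupp_vsize i); lia. Qed.

Lemma msupp_bound_vsize i u k : (forall m, m \in msupp u -> (m i < k)%N) ->
  (vsize i u <= k)%N.
Proof.
move=> h; apply/leq_sizeP => l kl; apply/mpolyP => m.
rewrite coef_as_poly mcoeff0; case: ifP => // _.
apply: memN_msupp_eq0; apply/negP => /h.
by rewrite mnmDE mulmnE mnm1E eqxx; lia.
Qed.

Lemma no_var_const u : (forall i, ~~ uses i u) -> exists c, u = c%:MP.
Proof.
move=> h; exists (u@_0); apply/mpolyP => m; rewrite mcoeffC.
case: eqP => [->|m0]; first by rewrite mulr1.
rewrite mulr0; apply: memN_msupp_eq0; apply/negP => hm; apply: m0.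
by apply/mnmP => i; rewrite mnm0E (unused_msupp (h i) hm).
Qed.

Lemma affine_split i u : (vsize i u <= 2)%N ->
  as_poly i u = ((as_poly i u)`_1)%:P * 'X + ((as_poly i u)`_0)%:P.
Proof. exact: poly_affine. Qed.

Lemma affine_eval i u : (vsize i u <= 2)%N ->
  u = (as_poly i u)`_1 * 'X_i + (as_poly i u)`_0.
Proof.
move=> /affine_split e; have := as_polyK i u. by rewrite {1}e hornerMXaddC hornerC.
Qed.

Lemma slope_neq0 i u : (vsize i u <= 2)%N -> uses i u -> (as_poly i u)`_1 != 0.
Proof.
rewrite /uses => h1 h2; have e : vsize i u = 2%N by apply/anti_leq/andP.
have : lead_coef (as_poly i u) != 0.
  by rewrite lead_coef_eq0 -size_poly_eq0 -/(vsize i u) e.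
by rewrite lead_coefE -/(vsize i u) e.
Qed.

Lemma mpoly_ring_ind (Q : S -> Prop) : (forall c, Q c%:MP) ->
  (forall i, Q 'X_i) -> (forall u v, Q u -> Q v -> Q (u + v)) ->
  (forall u v, Q u -> Q v -> Q (u * v)) -> forall u, Q u.
Proof.
move=> QC QX QD QM u; elim/mpolyind: u => [|c m u _ _ IH].
  by rewrite -mpolyC0; exact: QC.
apply (QD) => //; rewrite -mul_mpolyC; apply (QM); first exact: QC.
rewrite mpolyXE_id; elim/big_ind: _ => [|x y|i _].
- by rewrite -mpolyC1; exact: QC.
- exact: QM.
- elim: (m i) => [|k IHk]; first by rewrite expr0 -mpolyC1; exact: QC.
  by rewrite exprS; exact: QM.
Qed.

End OneVariable.

(** * Families of irreducible factors of a polynomial of degree at most one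
    in each variable *)

Section AffineFamilies.
Variables (K : fieldType) (n : nat).
Notation S := {mpoly K[n]}.
Implicit Types (a b f g h u v w : S) (i j z : 'I_n) (fs gs : seq S).

Definition multiaffine u := forall i, (vsize i u <= 2)%N.

Lemma square_free_multiaffine u : square_free_supported u -> multiaffine u.
Proof. by move=> sq i; apply: msupp_bound_vsize => m /sq/(_ i). Qed.

Lemma mpoly_unitP u : u \is a GRing.unit -> exists2 c, c != 0 & u = c%:MP.
Proof.
by move=> /andP[/eqP e]; rewrite unitfE => h; exists (u@_0).
Qed.

Lemma mpolyC_unit (c : K) : c != 0 -> c%:MP_[n] \is a GRing.unit.
Proof.
move=> c0; apply/unitrP; exists (c^-1)%:MP.
by rewrite -!mpolyCM mulVf ?mulfV ?mpolyC1.
Qed.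

Lemma irr_neq0 a : irreducible_element a -> a != 0.
Proof. by case. Qed.

Lemma irr_uses a : irreducible_element a -> exists i, uses i a.
Proof.
case=> a0 au _; apply: contrapT => h.
have [c ac] : exists c, a = c%:MP.
  by apply: no_var_const => i; apply/negP => hi; apply: h; exists i.
by move: au; rewrite ac mpolyC_unit // -(mpolyC_eq0 n) -ac.
Qed.

Lemma prod_irr_neq0 fs : (forall a, a \in fs -> irreducible_element a) ->
  \prod_(a <- fs) a != 0.
Proof.
by move=> h; rewrite prodf_seq_neq0; apply/allP => a /h /irr_neq0.
Qed.

Lemma uses_prod fs i : (forall a, a \in fs -> irreducible_element a) ->
  uses i (\prod_(a <- fs) a) = has (uses i) fs.
Proof.
elim: fs => [|a fs IH] irr /=.
  by rewrite big_nil -mpolyC1 (negPf (unusedC _ _)).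
have irr' b : b \in fs -> irreducible_element b.
  by move=> hb; apply: irr; rewrite inE hb orbT.
rewrite big_cons usesM ?IH ?prod_irr_neq0 //.
by apply/irr_neq0/irr; rewrite inE eqxx.
Qed.

Lemma prod_cat fs gs : \prod_(a <- fs ++ gs) a =
  (\prod_(a <- fs) a) * (\prod_(a <- gs) a).
Proof. by rewrite big_cat. Qed.

Definition affine_family fs :=
  (forall a, a \in fs -> irreducible_element a) /\
  multiaffine (\prod_(a <- fs) a).

Lemma family_perm fs gs : perm_eq fs gs -> affine_family fs ->
  affine_family gs.
Proof.
move=> e [h1 h2]; split=> [a|]; first by rewrite -(perm_mem e); exact: h1.
by move=> i; rewrite -(perm_big _ e).
Qed.

Lemma family_catr fs gs : affine_family (fs ++ gs) -> affine_family gs.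
Proof.
move=> [h1 h2].
have hf a : a \in fs -> irreducible_element a.
  by move=> ha; apply: h1; rewrite mem_cat ha.
have hg a : a \in gs -> irreducible_element a.
  by move=> ha; apply: h1; rewrite mem_cat ha orbT.
split; first exact: hg.
move=> i; move: (h2 i); rewrite prod_cat vsizeM ?prod_irr_neq0 //.
by have := vsize_gt0 i (\prod_(a <- fs) a); rewrite prod_irr_neq0 //; lia.
Qed.

Lemma family_filter (p : pred S) fs :
  affine_family fs -> affine_family (filter p fs).
Proof.
move=> h; apply: (@family_catr (filter (predC p) fs)).
by apply: family_perm h; rewrite perm_sym perm_catC; exact/permPl/perm_filterC.
Qed.

Lemma family_tail a fs : affine_family (a :: fs) -> affine_family fs.
Proof. exact: (@family_catr [:: a]). Qed.

Lemma family_irr fs a : affine_family fs -> a \in fs -> irreducible_element a.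
Proof. by case=> h _; exact: h. Qed.

Lemma family_headW a fs : affine_family (a :: fs) -> affine_family [:: a].
Proof.
move=> h; apply: (@family_catr fs); apply: family_perm h.
by rewrite perm_sym -cat1s perm_catC.
Qed.

Lemma family_head a fs : affine_family (a :: fs) -> multiaffine a.
Proof. by move=> /family_headW[_]; rewrite big_seq1. Qed.

Lemma family_disjoint a fs b i : affine_family (a :: fs) -> b \in fs ->
  uses i a -> ~~ uses i b.
Proof.
move=> h hb; have [irr aff] := h; have [irr' _] := family_tail h.
have a0 : a != 0 by apply/irr_neq0/irr; rewrite inE eqxx.
move=> ua; apply/negP => ub.
have : uses i (\prod_(c <- fs) c) by rewrite uses_prod //; apply/hasP; exists b.
have := aff i; rewrite big_cons vsizeM ?prod_irr_neq0 //.
by move: ua; rewrite /uses; lia.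
Qed.

(** Stated with [rem], so that it also excludes a repeated member. *)
Lemma family_shared fs a b i : affine_family fs -> a \in fs ->
  b \in rem a fs -> uses i a -> ~~ uses i b.
Proof.
move=> h ha; apply: family_disjoint.
exact: family_perm (perm_to_rem ha) h.
Qed.

Lemma family_replace a fs gs : affine_family (a :: fs) ->
  (forall b, b \in gs -> irreducible_element b) ->
  (forall i, vsize i (\prod_(b <- gs) b) <= vsize i a)%N ->
  affine_family (gs ++ fs).
Proof.
move=> h irrg le; have [irr aff] := h; have [irr' _] := family_tail h.
have a0 : a != 0 by apply/irr_neq0/irr; rewrite inE eqxx.
split; first by move=> b; rewrite mem_cat => /orP[/irrg|/irr'].
move=> i.
have := aff i; have := le i; have := vsize_gt0 i (\prod_(b <- gs) b).
rewrite big_cons prod_cat (vsizeM i a0 (prod_irr_neq0 irr')).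
rewrite (vsizeM i (prod_irr_neq0 irrg) (prod_irr_neq0 irr')).
rewrite (prod_irr_neq0 irrg); lia.
Qed.

Lemma factorization u : u != 0 -> exists (c : K) gs,
  [/\ c != 0, u = c *: \prod_(b <- gs) b &
      forall b, b \in gs -> irreducible_element b].
Proof.
have [N] := ubnP (msize u); elim: N u => // N IH u hN u0.
have [/mpoly_unitP[c c0 ->]|uu] := boolP (u \is a GRing.unit).
  by exists c, [::]; rewrite big_nil -mul_mpolyC mulr1.
have [irr|] := pselect (irreducible_element u).
  exists 1, [:: u]; rewrite scale1r big_seq1; split=> // [|b].
    exact: oner_neq0.
  by rewrite inE => /eqP ->.
move=> nirr; have [b [c [e bu cu]]] : exists b c,
    [/\ u = b * c, b \isn't a GRing.unit & c \isn't a GRing.unit].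
  apply: contrapT => h; apply: nirr; split=> // b c e.
  have [|bu] := boolP (b \is a GRing.unit); first by left.
  have [|cu] := boolP (c \is a GRing.unit); first by right.
  by case: h; exists b, c.
have [b0 c0] : b != 0 /\ c != 0.
  by move: u0; rewrite e mulf_eq0 => /norP.
have big v : v != 0 -> v \isn't a GRing.unit -> (1 < msize v)%N.
  move=> v0 vu; rewrite ltnNge; apply: contra vu => /msize1_polyC e1.
  by rewrite e1 mpolyC_unit // -(mpolyC_eq0 n) -e1.
have es : msize u = (msize b + msize c).-1 by rewrite e; exact: msizeM.
have [hb hc] := (big _ b0 bu, big _ c0 cu).
have [|k [bs [k0 eb bi]]] := IH b _ b0; first by move: hN; rewrite es; lia.
have [|l [cs [l0 ec ci]]] := IH c _ c0; first by move: hN; rewrite es; lia.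
exists (k * l), (bs ++ cs); split; first by rewrite mulf_neq0.
  by rewrite e eb ec prod_cat -scalerAl -scalerAr scalerA.
by move=> d; rewrite mem_cat => /orP[/bi|/ci].
Qed.

(** The extension to [S] of the contraction of [A] to the polynomials free of
    the [i]-th variable. *)
Definition coef_ideal (A : ideal S) i : ideal S :=
  phi_coef_ideal (as_poly i) A.

Lemma coef_idealE (A : ideal S) i u :
  coef_ideal A i u = forall k, A ((as_poly i u)`_k).
Proof. by []. Qed.

Lemma coef_ideal_prime (P : ideal S) i :
  prime_ideal P -> prime_ideal (coef_ideal P i).
Proof. exact: phi_coef_ideal_prime. Qed.

Opaque coef_ideal.

Lemma coef_ideal_unused (A : ideal S) i u : ~~ uses i u ->
  (coef_ideal A i) u <-> A u.
Proof. by move=> /unused_const e; rewrite coef_idealE e; exact: poly_idealC. Qed.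

Lemma coef_ideal_sub (A : ideal S) i u : coef_ideal A i u -> A u.
Proof.
rewrite coef_idealE => h; rewrite -[u](as_polyK i) horner_coef.
by apply: ideal_sum => k _; exact: ideal_mulr.
Qed.

Lemma span_coef fs i u k : (forall b, b \in fs -> ~~ uses i b) ->
  ideal_span fs u -> ideal_span fs (as_poly i u)`_k.
Proof.
move=> h hu; have : coef_ideal (ideal_span fs) i u; last exact.
apply: ideal_span_sub hu => b hb; apply/coef_ideal_unused; first exact: h.
exact: ideal_span_mem.
Qed.

Lemma eliminate_head a fs z u : (vsize z a <= 2)%N ->
  (forall b, b \in fs -> ~~ uses z b) -> ~~ uses z u ->
  ideal_span (a :: fs) u ->
  exists N, ideal_span fs ((as_poly z a)`_1 ^+ N * u).
Proof.
move=> az bz uz /ideal_span_cons[w hw]; exists (size (as_poly z w)).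
apply: (@eliminate_affine _ _ _ _ (as_poly z a)`_0) => k.
rewrite -(affine_split az) -(unused_const uz) -rmorphM -rmorphB.
exact: span_coef.
Qed.

(** If [u] lacks a variable [z] of the member [a = g z + h], then substituting
    [- h / g] for [z] kills [a] and fixes [u] as well as the other members.
    Doing so for one member after the other sends [u] to [0] while fixing it. *)
Lemma span_vars fs u : affine_family fs -> ideal_span fs u ->
  (forall a, a \in fs -> exists z, uses z a && ~~ uses z u) -> u = 0.
Proof.
elim: fs u => [|a fs IH] u fam hu hz; first exact: ideal_span_nil.
have [z /andP[za zu]] := hz a (mem_head _ _).
have az : (vsize z a <= 2)%N by exact: family_head fam z.
have bz b : b \in fs -> ~~ uses z b by move=> hb; exact: family_disjoint fam hb za.
have [N hN] := eliminate_head az bz zu hu.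
have : (as_poly z a)`_1 ^+ N * u = 0.
  apply: IH hN _; first exact: family_tail fam.
  move=> b hb; have [y /andP[yb yu]] := hz b (mem_behead (s := a :: fs) hb).
  have ya : ~~ uses y a.
    by apply: contraTN yb => ya; exact: family_disjoint fam hb ya.
  exists y; apply/andP; split; first exact: yb.
  by apply: unusedM yu; apply: unusedX; exact: unused_coef.
move/eqP; rewrite mulf_eq0 => /orP[|/eqP //].
by rewrite expf_eq0 (negPf (slope_neq0 az za)) andbF.
Qed.

Lemma span1 b u : ideal_span [:: b] u -> exists w, u = w * b.
Proof. by move=> /ideal_span_cons[w /ideal_span_nil /subr0_eq]; exists w. Qed.

(** With [be] and [A] the coefficients of [z] in [b] and [h], the combination
    [be h - A b] is free of [z], hence zero by [span_vars]. So the prime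
    element [b] divides [h] or [be]; but [be], nonzero and free of [z], is not
    a multiple of [b]. *)
Lemma span_dvd b fs h : affine_family (b :: fs) ->
  prime_ideal (ideal_span [:: b]) -> multiaffine h ->
  (forall a, a \in fs -> exists z, uses z a && ~~ uses z h) ->
  ideal_span (b :: fs) h -> ideal_span [:: b] h.
Proof.
move=> fam pr hh hz hsp.
have birr : irreducible_element b by apply: family_irr fam _; exact: mem_head.
have [z zb] := irr_uses birr; have baff := family_head fam.
set A := (as_poly z h)`_1; set be := (as_poly z b)`_1.
have e : be * h - A * b = be * (as_poly z h)`_0 - A * (as_poly z b)`_0.
  rewrite {1}(affine_eval (hh z)) {1}(affine_eval (baff z)).
  exact: cross_elim.
have w0 : be * h - A * b = 0.
  apply: (span_vars fam).
    apply: idealB; apply: ideal_mull => //; apply: ideal_span_mem; exact: mem_head.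
  move=> a; rewrite inE => /orP[/eqP ->|ha].
    exists z; rewrite zb e /=; apply: unusedD; last apply: unusedN.
      exact: unusedM (coef_unused _ _ _) (coef_unused _ _ _).
    exact: unusedM (coef_unused _ _ _) (coef_unused _ _ _).
  have [y /andP[ya yh]] := hz a ha; exists y; rewrite ya /=.
  have yb : ~~ uses y b by apply: contraTN ya => yb; exact: family_disjoint fam ha yb.
  apply: unusedD; last apply: unusedN.
    exact: unusedM (unused_coef _ _ yb) yh.
  exact: unusedM (unused_coef _ _ yh) yb.
have : ideal_span [:: b] (be * h) by rewrite (subr0_eq w0); exact: ideal_span_head.
case/pr.2 => [hbe|]; last by [].
have : be = 0.
  apply: (span_vars (family_headW fam)) => // a; rewrite inE => /eqP ->.
  by exists z; rewrite zb /= coef_unused.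
by move=> be0; case/negP: (slope_neq0 (baff z) zb); exact/eqP.
Qed.

(** The polynomials [u] that admit such a division form a subring, which
    contains [z] because [g z = - h + a]. *)
Lemma pseudo_division a z u : (vsize z a <= 2)%N ->
  exists N w v, ~~ uses z v /\ (as_poly z a)`_1 ^+ N * u = v + w * a.
Proof.
move=> az; set g := (as_poly z a)`_1; pose h := (as_poly z a)`_0.
have ea : a = g * 'X_z + h by exact: affine_eval az.
have hg : ~~ uses z g := coef_unused _ _ _.
elim/mpoly_ring_ind: u => [c|i|u v [N [w [r [hr e]]]] [M [x [s [hs e']]]]
    |u v [N [w [r [hr e]]]] [M [x [s [hs e']]]]].
- exists 0%N, 0, c%:MP; split; [exact: unusedC|exact: pseudo_free].
- have [->|iz] := eqVneq i z.
    exists 1%N, 1, (- h); split; last exact: pseudo_var ea.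
    by apply: unusedN; exact: coef_unused.
  exists 0%N, 0, 'X_i; split; last exact: pseudo_free.
  apply: (@const_unused _ _ _ _ 'X_i); rewrite as_polyX mnm1E (negPf iz).
  rewrite expr0 mulr1; congr (_)%:P; congr 'X_[_].
  by apply/mnmP => j; rewrite mnmBE mulmnE; lia.
- exists (N + M)%N, (g ^+ M * w + g ^+ N * x), (g ^+ M * r + g ^+ N * s).
  split; last exact: pseudo_add.
  by apply: unusedD; [apply: unusedM hr|apply: unusedM hs]; exact: unusedX.
- exists (N + M)%N, (w * (s + x * a) + r * x), (r * s).
  by split; [exact: unusedM|exact: pseudo_mul].
Qed.

Definition var_count u := #|[pred i | uses i u]|.

Lemma var_count_le u v : (forall j, uses j u -> uses j v) ->
  (var_count u <= var_count v)%N.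
Proof. by move=> sub; apply/subset_leq_card/fintype.subsetP => j; exact: sub. Qed.

Lemma var_count_lt u v i : (forall j, uses j u -> uses j v) ->
  uses i v -> ~~ uses i u -> (var_count u < var_count v)%N.
Proof.
move=> sub iv iu; apply/proper_card/properP; split.
  by apply/fintype.subsetP => j; exact: sub.
by exists i; [exact: iv|exact: iu].
Qed.

End AffineFamilies.

(** ** Primality of the ideal of a family *)

Section FamilyPrimality.
Variables (K : fieldType) (n : nat).
Notation S := {mpoly K[n]}.
Implicit Types (a b f g h u v w : S) (i j z : 'I_n) (fs gs : seq S).

Lemma ideal_scale (A : ideal S) (c : K) u : c != 0 -> A (c *: u) -> A u.
Proof.
move=> c0; rewrite -mul_mpolyC => /(ideal_mull (c^-1)%:MP).
by rewrite mulrA -mpolyCM mulVf // mpolyC1 mul1r.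
Qed.

Lemma vsizeZ i (c : K) u : c != 0 -> vsize i (c *: u) = vsize i u.
Proof.
move=> c0; have [->|u0] := eqVneq u 0; first by rewrite scaler0.
rewrite -mul_mpolyC vsizeM ?mpolyC_eq0 //.
by rewrite /vsize as_polyC size_polyC mpolyC_eq0 c0.
Qed.

Lemma usesZ i (c : K) u : c != 0 -> uses i (c *: u) = uses i u.
Proof. by move=> c0; rewrite /uses vsizeZ. Qed.

Opaque vsize uses.

Lemma var_count_family fs gs z :
  (forall a, a \in fs -> irreducible_element a) ->
  (forall a, a \in gs -> irreducible_element a) ->
  (forall a, a \in fs -> forall j, uses j a -> has (uses j) gs) ->
  has (uses z) gs -> (forall a, a \in fs -> ~~ uses z a) ->
  (var_count (\prod_(a <- fs) a) < var_count (\prod_(a <- gs) a))%N.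
Proof.
move=> hf hg sub zg zf; apply: (@var_count_lt _ _ _ _ z) => [j||].
- by rewrite (uses_prod _ hf) (uses_prod _ hg) => /hasP[a ha ja]; exact: sub ja.
- by rewrite (uses_prod _ hg).
- by rewrite (uses_prod _ hf); apply/hasPn.
Qed.

(** The descent in the inductions on the number of variables. A coefficient of
    [a] has at most the degree of [a] in each variable, so that replacing [a]
    by the factors of the coefficient preserves the bound on the degrees. *)
Lemma coef_factor a fs z k : affine_family (a :: fs) -> uses z a ->
  (as_poly z a)`_k != 0 -> exists (c : K) gs,
  [/\ c != 0, (as_poly z a)`_k = c *: \prod_(b <- gs) b,
      affine_family (gs ++ fs),
      forall b, b \in gs -> forall j, uses j b -> uses j a /\ j != z &
      (var_count (\prod_(b <- gs ++ fs) b) <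
       var_count (\prod_(b <- a :: fs) b))%N].
Proof.
move=> fam za u0; have [c [gs [c0 e irrg]]] := factorization u0.
have vs i : vsize i (\prod_(b <- gs) b) = vsize i (as_poly z a)`_k.
  by rewrite e vsizeZ.
have famg : affine_family (gs ++ fs).
  by apply: family_replace fam irrg _ => i; rewrite vs; exact: vsize_coef.
have ub b : b \in gs -> forall j, uses j b -> uses j a /\ j != z.
  move=> hb j jb; have : uses j (as_poly z a)`_k.
    rewrite e.
    rewrite (usesZ j _ c0).
    rewrite (uses_prod _ irrg).
    by apply/hasP; exists b.
  move=> ju; split; first exact: uses_coef ju.
  by apply: contraTneq ju => ->; exact: coef_unused.
exists c, gs; split=> //; apply: (var_count_family (z := z)) => [b|b|b||b].
- exact: family_irr famg.
- exact: family_irr fam.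
- rewrite mem_cat => /orP[hb j /(ub b hb)[ja _] /=|hb j jb /=].
    by rewrite ja.
  by apply/orP; right; apply/hasP; exists b.
- by rewrite /= za.
- rewrite mem_cat => /orP[hb|hb]; last exact: family_disjoint fam hb za.
  by apply/negP => /(ub b hb)[_]; rewrite eqxx.
Qed.

Lemma family_pick gs fs b : affine_family (gs ++ fs) -> b \in gs ->
  affine_family (b :: fs).
Proof.
move=> h hb; apply: (@family_catr _ _ (rem b gs)); apply: family_perm h.
by rewrite perm_sym -cat_rcons perm_cat // perm_rcons perm_sym perm_to_rem.
Qed.

Lemma notin_span_tail a fs g : affine_family (a :: fs) ->
  (forall j, uses j g -> uses j a) -> g != 0 -> ~ ideal_span fs g.
Proof.
move=> fam sub g0 hg; case/negP: g0; apply/eqP.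
apply: (span_vars (family_tail fam) hg) => b hb.
have [z zb] := irr_uses (family_irr (family_tail fam) hb).
exists z; rewrite zb; apply/negP => /sub za.
by move: zb; rewrite (negPf (family_disjoint fam hb za)).
Qed.

(** Write [a = g z + h], and let [J'] be the ideal of the other members, prime
    by induction. The quotient by [a] and [J'] embeds, by [z = - h / g], into
    the field of fractions of the [z]-free polynomials modulo [J'], provided
    that [g] is not a zero divisor in it. It suffices to cancel an irreducible
    factor [b] of [g]. If [b u = w a] modulo [J'], then, as [(b) + J'] is prime
    by induction, it contains [w] or [a]. In the first case [b] cancels. In
    the second it contains [h], so [b] divides [h] by [span_dvd], and [a] is
    not irreducible. *)
Theorem family_prime fs : affine_family fs -> prime_ideal (ideal_span fs).
Proof.
have [N] := ubnP (var_count (\prod_(a <- fs) a)).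
elim: N fs => // N IH [|a fs] hN fam.
  split=> [/ideal_span_nil/eqP|u v /ideal_span_nil/eqP]; first by rewrite oner_eq0.
  rewrite mulf_eq0 => /orP[]/eqP ->; [left|right]; exact: (ideal0 (ideal_span _)).
have airr : irreducible_element a by apply: family_irr fam _; exact: mem_head.
have [z za] := irr_uses airr.
have aff := family_head fam.
have g0 := slope_neq0 (aff z) za.
have [c [gs [c0 eg famg ug vlt]]] := coef_factor fam za g0.
set g := (as_poly z a)`_1 in g0 eg *.
have zfs b : b \in fs -> ~~ uses z b by move=> hb; exact: family_disjoint fam hb za.
have smaller ds : affine_family ds -> {subset ds <= gs ++ fs} ->
    prime_ideal (ideal_span ds).
  move=> famd sub; apply: (IH _ _ famd); apply: (leq_trans (n := (var_count (\prod_(b <- gs ++ fs) b)).+1)).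
    rewrite ltnS; apply: var_count_le => j.
    rewrite (uses_prod j (fun b => family_irr famd (a := b))).
    rewrite (uses_prod j (fun b => family_irr famg (a := b))).
    by move=> /hasP[b /sub hb jb]; apply/hasP; exists b.
  exact: leq_trans vlt hN.
have prJ' : prime_ideal (ideal_span fs).
  by apply: smaller (family_tail fam) _ => b hb; rewrite mem_cat hb orbT.
have gJ' : ~ ideal_span fs g.
  by apply: (notin_span_tail fam) g0 => j; exact: uses_coef.
have cancel_factor b u : b \in gs -> ideal_span (a :: fs) (b * u) ->
    ideal_span (a :: fs) u.
  move=> hb hbu; have famb := family_pick famg hb.
  have birr := family_irr famb (mem_head b fs).
  have bz : ~~ uses z b by apply/negP => /(ug b hb)[_]; rewrite eqxx.
  have bfsz e : e \in b :: fs -> ~~ uses z e.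
    by rewrite inE => /orP[/eqP ->|]; [exact: bz|exact: zfs].
  have prb : prime_ideal (ideal_span (b :: fs)).
    apply: smaller famb _ => e; rewrite inE mem_cat => /orP[/eqP ->|->].
      by rewrite hb.
    by rewrite orbT.
  have prb1 : prime_ideal (ideal_span [:: b]).
    apply: smaller (family_headW famb) _ => e; rewrite inE mem_cat => /eqP ->.
    by rewrite hb.
  have bJ' : ~ ideal_span fs b.
    exact: (notin_span_tail famb (fun j jb => jb) (irr_neq0 birr)).
  have [w hw] := ideal_span_cons hbu.
  have : ideal_span (b :: fs) (w * a).
    rewrite -[w * a](subKr (b * u)); apply: idealB.
      by rewrite mulrC; exact: ideal_span_head.
    exact: ideal_span_tail.
  case/prb.2 => [/ideal_span_cons[w' hw']|ha].
    have : ideal_span fs (b * (u - w' * a)).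
      apply: (ideal_subl (y := (w - w' * b) * a)); last exact: ideal_mulr.
      by rewrite pseudo_swap.
    case/prJ'.2 => [/bJ' []|hu]; apply: (ideal_subl (y := w' * a)).
      exact: ideal_span_tail.
    exact: ideal_span_head.
  have hh : ideal_span [:: b] (as_poly z a)`_0.
    apply: (span_dvd famb prb1) => [i|e he|]; last exact: span_coef.
      exact: leq_trans (vsize_coef _ _ _ _) (aff i).
    have [y ye] := irr_uses (family_irr (family_tail famb) he).
    exists y; rewrite ye; apply: contraTN ye => /uses_coef ya.
    exact: family_disjoint fam he ya.
  have [hw1 e1] := span1 hh.
  have [hw2 e2] : exists w2, g = w2 * b.
    by exists (c *: \prod_(e <- rem b gs) e); rewrite eg (big_rem b hb) -scalerAl mulrC.
  case: airr => _ _ irra; case: birr => _ bu _.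
  have ea : a = b * (hw2 * 'X_z + hw1).
    by rewrite {1}(affine_eval (aff z)) -/g e2 e1; exact: factor_affine.
  case: (irra _ _ ea) => [bU|]; first by case/negP: bu.
  move=> /mpoly_unitP[k k0 ek]; case/negP: bz.
  by rewrite -(usesZ z b k0) -mul_mpolyC mulrC -ek -ea.
have cancel_prod ds u : {subset ds <= gs} ->
    ideal_span (a :: fs) ((\prod_(b <- ds) b) * u) -> ideal_span (a :: fs) u.
  elim: ds => [|b ds IHd] sub; first by rewrite big_nil mul1r.
  rewrite big_cons -mulrA => /(cancel_factor b _ (sub b (mem_head b ds))).
  by apply: IHd => e he; apply: sub; rewrite inE he orbT.
have cancel_g u M : ideal_span (a :: fs) (g ^+ M * u) -> ideal_span (a :: fs) u.
  elim: M => [|M IHM]; first by rewrite expr0 mul1r.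
  by rewrite exprS -mulrA {1}eg -scalerAl => /(ideal_scale c0)/(cancel_prod gs)/IHM; apply.
have pull u : ~~ uses z u -> ideal_span (a :: fs) u -> ideal_span fs u.
  move=> uz hu; have [M] := eliminate_head (aff z) zfs uz hu.
  by case/prJ'.2 => [/(prime_exp prJ')/gJ' []|].
split=> [h1|u v huv].
  by apply: prJ'.1; apply: pull h1; rewrite -mpolyC1 unusedC.
have [M [w [r [zr er]]]] := pseudo_division u (aff z).
have [L [x [s [zs es]]]] := pseudo_division v (aff z).
have : ideal_span fs (r * s).
  apply: pull; first exact: unusedM.
  have e := pseudo_mul er es; rewrite -[r * s](addrK ((w * (s + x * a) + r * x) * a)) -e.
  by apply: idealB; [exact: ideal_mull|exact: ideal_span_head].
have back y q k l : g ^+ k * y = q + l * a -> ideal_span fs q ->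
    ideal_span (a :: fs) y.
  move=> e hq; apply: (cancel_g _ k); rewrite e; apply: idealD.
    exact: ideal_span_tail.
  exact: ideal_span_head.
by case/prJ'.2; [left; exact: back er _|right; exact: back es _].
Qed.

End FamilyPrimality.

(** * A Frobenius trace on polynomials *)

Lemma frobeniusD (R : comNzRingType) p : p \in [pchar R] ->
  forall x y : R, (x + y) ^+ p = x ^+ p + y ^+ p.
Proof. by move=> cR x y; have := rmorphD (pFrobenius_aut cR) x y. Qed.

Lemma frobeniusN (R : comNzRingType) p : p \in [pchar R] ->
  forall x : R, (- x) ^+ p = - x ^+ p.
Proof. by move=> cR x; have := rmorphN (pFrobenius_aut cR) x. Qed.

(** A maximal [K ^ p]-subspace avoiding [1] is a complement of [K ^ p]; the
    projection to [K ^ p] along it, followed by the [p]-th root, is the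
    splitting. *)
Lemma frobenius_splitting (K : fieldType) p : p \in [pchar K] ->
  exists lam : K -> K, [/\ forall x y, lam (x + y) = lam x + lam y,
    forall a x, lam (a ^+ p * x) = a * lam x & lam 1 = 1].
Proof.
move=> cK; have p0 : (0 < p)%N by case/andP: cK => /prime_gt0.
pose Q (W : set K) := [/\ forall x y, W x -> W y -> W (x + y),
  forall a x, W x -> W (a ^+ p * x) & ~ W 1].
have [W [[WD WM W1] Wmax]] : exists W, Q W /\ forall B, (W `<` B)%classic -> ~ Q B.
  apply: Zorn_bigcup => F FQ Ftot; split.
  - move=> x y [X FX Xx] [Y FY Yy]; case: (Ftot _ _ FX FY) => h.
      by exists Y => //; case: (FQ _ FY) => D _ _; apply: D => //; exact: h.
    by exists X => //; case: (FQ _ FX) => D _ _; apply: D => //; exact: h.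
  - by move=> a x [X FX Xx]; exists X => //; case: (FQ _ FX) => _ M _; exact: M.
  - by move=> [X FX X1]; case: (FQ _ FX).
pose W0 x := W x \/ x = 0.
have W0D x y : W0 x -> W0 y -> W0 (x + y).
  move=> [hx|->] [hy|->]; rewrite ?addr0 ?add0r; try by [left|right].
  by left; exact: WD.
have W0M a x : W0 x -> W0 (a ^+ p * x).
  by move=> [hx|->]; [left; exact: WM|right; rewrite mulr0].
have W0N x : W0 x -> W0 (- x).
  by move=> /(W0M (-1)); rewrite frobeniusN // expr1n mulN1r.
have W01 : ~ W0 1 by move=> [//|/eqP]; rewrite oner_eq0.
have split b : exists c, W0 (b - c ^+ p).
  have [bW|bW] := pselect (W b).
    by exists 0; rewrite expr0n eqn0Ngt p0 subr0; left.
  pose B : set K := fun x => exists w a, W0 w /\ x = w + a ^+ p * b.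
  have [w [a [hw e1]]] : B 1.
    apply: contrapT => B1; apply: (Wmax B).
      split=> [x Wx|h].
        by exists x, 0; split; [left|rewrite expr0n eqn0Ngt p0 /=; ring].
      by apply: bW; apply: h; exists 0, 1; split; [right|rewrite expr1n; ring].
    split=> // [x y [w [a [hw ->]]] [v [c [hv ->]]]|c x [w [a [hw ->]]]].
      exists (w + v), (a + c); split; first exact: W0D.
      by rewrite frobeniusD //; ring.
    exists (c ^+ p * w), (c * a); split; first exact: W0M.
    by rewrite exprMn; ring.
  have a0 : a != 0.
    apply/eqP => a0; apply: W01; rewrite e1 a0 expr0n eqn0Ngt p0 /= mul0r addr0.
    exact: hw.
  exists a^-1; have -> : b - a^-1 ^+ p = (- a^-1) ^+ p * w.
    have -> : w = 1 - a ^+ p * b by rewrite [1]e1 addrK.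
    rewrite frobeniusN // exprVn mulNr mulrBr mulr1 mulrA mulVf ?expf_neq0 //.
    by ring.
  exact: W0M.
have uniq b c d : W0 (b - c ^+ p) -> W0 (b - d ^+ p) -> c = d.
  move=> hc hd; apply/eqP; rewrite -subr_eq0; apply/negPn/negP => cd.
  apply: W01; have -> : 1 = (c - d)^-1 ^+ p * (c - d) ^+ p.
    by rewrite -exprMn mulVf // expr1n.
  apply: W0M; rewrite frobeniusD // frobeniusN //.
  have -> : c ^+ p - d ^+ p = (b - d ^+ p) - (b - c ^+ p) by ring.
  by apply: W0D => //; exact: W0N.
have [lam hlam] := choice split; exists lam; split=> [x y|a x|].
- apply: (uniq (x + y)) => //; rewrite frobeniusD //.
  have -> : x + y - (lam x ^+ p + lam y ^+ p) = (x - lam x ^+ p) + (y - lam y ^+ p).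
    by ring.
  exact: W0D.
- apply: (uniq (a ^+ p * x)) => //; rewrite exprMn -mulrBr; exact: W0M.
- by apply: (uniq 1) => //; rewrite expr1n subrr; right.
Qed.

Section Trace.
Variables (K : fieldType) (n p : nat) (charK : p \in [pchar K]).
Variable lam : K -> K.
Hypothesis lamD : forall x y, lam (x + y) = lam x + lam y.
Hypothesis lamM : forall a x, lam (a ^+ p * x) = a * lam x.
Hypothesis lam1 : lam 1 = 1.
Notation S := {mpoly K[n]}.
Implicit Types (u v f g h : S) (i : 'I_n) (m k : 'X_{1..n}).

Let p_gt1 : (1 < p)%N. Proof. by case/andP: charK => /prime_gt1. Qed.

Lemma lam0 : lam 0 = 0.
Proof. by have := lamM 0 0; rewrite mulr0 mul0r. Qed.

(** The exponents all of whose entries are [-1] modulo [p], indexed by their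
    quotients by [p]. *)
Definition top_digit m : 'X_{1..n} := (m *+ p + [multinom p.-1 | _ < n])%MM.

Lemma top_digitE m i : top_digit m i = (p * m i + p.-1)%N.
Proof. by rewrite mnmDE mulmnE mnmE mulnC. Qed.

(** The map [c x ^ (p m + (p - 1)) |-> lam c x ^ m], zero on the other
    monomials. The bound on [m] loses nothing, as [p m + (p - 1)] has degree
    at least that of [m]. *)
Definition trace u : S :=
  \sum_(m : 'X_{1..n < msize u}) lam (u@_(top_digit m)) *: 'X_[m].

Lemma mdeg_top_digit m : mdeg (top_digit m) = (p * mdeg m + n * p.-1)%N.
Proof.
rewrite !mdegE (eq_bigr _ (fun i _ => top_digitE m i)) big_split /= -big_distrr /=.
by rewrite sum_nat_const card_ord.
Qed.

Lemma mcoeff_trace u m : (trace u)@_m = lam (u@_(top_digit m)).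
Proof.
have [lt|ge] := ltnP (mdeg m) (msize u).
  exact: (mcoeff_mpoly (fun m => lam (u@_(top_digit m)))).
rewrite [u@_(top_digit m)]memN_msupp_eq0; last first.
  apply: msize_mdeg_ge; apply: leq_trans ge _; rewrite mdeg_top_digit.
  by rewrite (leq_trans _ (leq_addr _ _)) // leq_pmull // ltnW.
rewrite lam0 raddf_sum /= big1 // => m' _; rewrite mcoeffZ mcoeffX.
case: eqP => [e|_]; last by rewrite mulr0.
by move: (bmdeg m'); rewrite e ltnNge ge.
Qed.

Lemma traceD u v : trace (u + v) = trace u + trace v.
Proof. by apply/mpolyP => m; rewrite mcoeffD !mcoeff_trace mcoeffD lamD. Qed.

Lemma trace0 : trace 0 = 0.
Proof. by apply/mpolyP => m; rewrite mcoeff_trace !mcoeff0 lam0. Qed.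

Lemma trace_sum (I : Type) (r : seq I) (F : I -> S) :
  trace (\sum_(j <- r) F j) = \sum_(j <- r) trace (F j).
Proof.
elim: r => [|j r IH]; first by rewrite !big_nil trace0.
by rewrite !big_cons traceD IH.
Qed.

Lemma mcoeffMXif u k m :
  (u * 'X_[k])@_m = if (k <= m)%MM then u@_(m - k) else 0.
Proof.
case: ifP => [km|km]; first by rewrite -{1}(submK km) addmC mcoeffMX.
apply: memN_msupp_eq0; rewrite (perm_mem (msuppMX _ _)).
apply/mapP => -[m0 _ e]; case/negP: km; rewrite e.
by apply/mnm_lepP => i; rewrite mnmDE leq_addr.
Qed.

Lemma mpoly_char : p \in [pchar S].
Proof.
case/andP: charK => pp /eqP p0; apply/andP; split=> //.
by rewrite -mpolyC_nat p0 mpolyC0.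
Qed.

(** The exponent [p m + (p - 1)] dominates [p k] exactly when [m] dominates
    [k], so [T] is linear over [p]-th powers. *)
Lemma trace_frobenius u v : trace (u ^+ p * v) = u * trace v.
Proof.
elim/mpolyind: u => [|c k u _ _ IH].
  have p0 : (0 < p)%N by exact: ltnW.
  by rewrite expr0n eqn0Ngt p0 /= !mul0r trace0.
rewrite (frobeniusD mpoly_char) !mulrDl traceD IH; congr (_ + _).
rewrite exprZn mpolyXn -!scalerAl !(mulrC 'X_[_]).
apply/mpolyP => m; rewrite mcoeff_trace !mcoeffZ !mcoeffMXif lamM.
rewrite mcoeff_trace.
have -> : (k *+ p <= top_digit m)%MM = (k <= m)%MM.
  apply/mnm_lepP/mnm_lepP => h i; have := h i; rewrite top_digitE mulmnE.
    by move=> hh; rewrite -ltnS -(ltn_pmul2l (ltnW p_gt1)); lia.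
  by move=> hh; nia.
case: ifP => [/mnm_lepP km|_]; last by rewrite lam0.
congr (c * lam _@_ _); apply/mnmP => i.
by rewrite mnmBE !top_digitE mulmnE mnmBE; have := km i; nia.
Qed.

End Trace.

(** * Ideals compatible with the trace *)

Section Compatible.
Variables (K : fieldType) (n p : nat) (charK : p \in [pchar K]).
Variable lam : K -> K.
Hypothesis lamD : forall x y, lam (x + y) = lam x + lam y.
Hypothesis lamM : forall a x, lam (a ^+ p * x) = a * lam x.
Hypothesis lam1 : lam 1 = 1.
Notation S := {mpoly K[n]}.
Notation T := (trace p lam).
Implicit Types (a b f g h u v w : S) (i j z : 'I_n) (m k : 'X_{1..n})
  (fs gs : seq S) (A P : ideal S).

Let p_gt1 : (1 < p)%N. Proof. by case/andP: charK => /prime_gt1. Qed.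
Let pS : p.-1.+1 = p. Proof. by rewrite prednK // ltnW. Qed.
Let T_coef u m : (T u)@_m = lam (u@_(top_digit p m)).
Proof. exact: mcoeff_trace. Qed.
Let TD u v : T (u + v) = T u + T v. Proof. exact: traceD. Qed.
Let T_sum (I : Type) (r : seq I) (F : I -> S) :
  T (\sum_(j <- r) F j) = \sum_(j <- r) T (F j).
Proof. exact: trace_sum. Qed.
Let T_frob u v : T (u ^+ p * v) = u * T v.
Proof. exact: trace_frobenius. Qed.

Lemma mpolyXU_exp i r : ('X_i : S) ^+ r = 'X_[U_(i) *+ r].
Proof. by rewrite mpolyXn. Qed.

Lemma trace_low i u r : ~~ uses i u -> (r < p.-1)%N -> T (u * 'X_i ^+ r) = 0.
Proof.
move=> iu rp; apply/mpolyP => m; rewrite T_coef mcoeff0 mpolyXU_exp mcoeffMXif.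
case: ifP => _; last exact: lam0 lamM.
rewrite memN_msupp_eq0; first exact: lam0 lamM.
apply/negP => /(unused_msupp iu).
by rewrite mnmBE top_digitE // mulmnE mnm1E eqxx; lia.
Qed.

Lemma trace_unused i u : ~~ uses i u -> ~~ uses i (T (u * 'X_i ^+ p.-1)).
Proof.
move=> iu; rewrite -leqNgt; apply: msupp_bound_vsize => m.
rewrite mcoeff_msupp T_coef mpolyXU_exp mcoeffMXif.
case: ifP => _; last by rewrite (lam0 lamM) eqxx.
have [hm _|/memN_msupp_eq0 ->] := boolP ((top_digit p m - U_(i) *+ p.-1)%MM \in msupp u).
  have := unused_msupp iu hm; rewrite mnmBE top_digitE // mulmnE mnm1E eqxx.
  by have := p_gt1; nia.
by rewrite (lam0 lamM) eqxx.
Qed.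

(** If [f = w a], then [T (f ^ (p - 1) a c) = a T (w ^ (p - 1) c)], so the map
    [c |-> T (f ^ (p - 1) c)] descends to the quotient by any factor [a] of
    [f]. Its stable ideals are the compatible ideals of the theory of
    Frobenius splittings. *)
Definition compatible f A := forall c, A c -> A (T (f ^+ p.-1 * c)).

Lemma compatibleZ (c : K) f A : c != 0 -> compatible (c *: f) A -> compatible f A.
Proof.
move=> c0 h u hu; have := h _ (ideal_mull ((c ^+ p.-1)^-1)%:MP hu).
rewrite exprZn -mul_mpolyC mulrACA -mpolyCM mulfV ?expf_neq0 //.
by rewrite mpolyC1 mul1r.
Qed.

(** It is enough to test the products [c z ^ (p - 1)] with [c] free of [z],
    since [T] is linear over [z ^ p] and kills [c z ^ r] for [r < p - 1]. *)
Lemma coefficient_compatible z f P :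
  ~~ uses z f ->
  (forall c, ~~ uses z c -> P c -> P (T (f ^+ p.-1 * c * 'X_z ^+ p.-1))) ->
  compatible f (coef_ideal P z).
Proof.
move=> zf h c; rewrite coef_idealE => hc.
rewrite -[c](as_polyK z) horner_coef mulr_sumr T_sum.
apply: ideal_sum => k _; set ck := (as_poly z c)`_k.
have zc : ~~ uses z ck by exact: coef_unused.
have -> : f ^+ p.-1 * (ck * 'X_z ^+ k) =
    ('X_z ^+ (k %/ p)) ^+ p * (f ^+ p.-1 * ck * 'X_z ^+ (k %% p)).
  by rewrite {1}(divn_eq k p) exprD exprM; exact: mulr_extract.
rewrite T_frob; apply: ideal_mull.
have zfc : ~~ uses z (f ^+ p.-1 * ck) by apply: unusedM zc; exact: unusedX.
have [lt|ge] := ltnP (k %% p) p.-1.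
  by rewrite (trace_low zfc lt); exact: ideal0.
have -> : (k %% p)%N = p.-1.
  by have := ltn_pmod k (ltnW p_gt1); lia.
apply/coef_ideal_unused; first exact: trace_unused.
by apply: h zc _; exact: hc.
Qed.

(** Only the top power of [z] in the expansion of [(g z + h) ^ (p - 1)]
    survives [T] against a multiplier free of [z]; after a shift by
    [z ^ (p - 1)], only the bottom one does. *)
Lemma compatible_slope z a F P : (vsize z a <= 2)%N -> ~~ uses z F ->
  compatible (a * F) P -> compatible ((as_poly z a)`_1 * F) (coef_ideal P z).
Proof.
move=> az zF comp; set g := (as_poly z a)`_1; pose h := (as_poly z a)`_0.
have zg : ~~ uses z g by exact: coef_unused.
have zh : ~~ uses z h by exact: coef_unused.
apply: coefficient_compatible => [|c zc hc]; first exact: unusedM.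
have := comp _ hc.
have -> : (a * F) ^+ p.-1 * c = (F ^+ p.-1 * c) * (g * 'X_z + h) ^+ p.-1.
  rewrite -(affine_eval az) exprMn; exact: mulr_rotl.
have zv : ~~ uses z (F ^+ p.-1 * c) by apply: unusedM zc; exact: unusedX.
rewrite affine_pow_top TD T_sum big1 ?addr0 => [|j _]; last first.
  apply: trace_low; last by have := ltn_ord j; lia.
  rewrite -mulr_natl -mpolyC_nat; apply: unusedM; first exact: unusedC.
  apply: unusedM; last exact: unusedX.
  by apply: unusedM zv _; exact: unusedX.
suff -> : F ^+ p.-1 * c * g ^+ p.-1 = (g * F) ^+ p.-1 * c by [].
by rewrite exprMn; exact: mulr_rotr.
Qed.

Lemma compatible_const z a F P : (vsize z a <= 2)%N -> ~~ uses z F ->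
  compatible (a * F) P -> compatible ((as_poly z a)`_0 * F) (coef_ideal P z).
Proof.
move=> az zF comp; pose g := (as_poly z a)`_1; set h := (as_poly z a)`_0.
have zg : ~~ uses z g by exact: coef_unused.
have zh : ~~ uses z h by exact: coef_unused.
apply: coefficient_compatible => [|c zc hc]; first exact: unusedM.
have := comp _ (ideal_mull ('X_z ^+ p.-1) hc).
have -> : (a * F) ^+ p.-1 * ('X_z ^+ p.-1 * c) =
    'X_z ^+ p.-1 * ((F ^+ p.-1 * c) * (g * 'X_z + h) ^+ p.-1).
  rewrite -(affine_eval az) exprMn; exact: mulr_extract_rot.
have zv : ~~ uses z (F ^+ p.-1 * c) by apply: unusedM zc; exact: unusedX.
rewrite affine_pow_bottom TD T_sum big1 ?addr0 => [|j _]; last first.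
  rewrite pS T_frob trace_low ?mulr0; [by []| |exact: ltn_ord].
  rewrite -mulr_natl -mpolyC_nat; apply: unusedM; first exact: unusedC.
  apply: unusedM; last exact: unusedX.
  by apply: unusedM zv _; exact: unusedX.
suff -> : F ^+ p.-1 * c * h ^+ p.-1 = (h * F) ^+ p.-1 * c by [].
by rewrite exprMn; exact: mulr_rotr.
Qed.

(** Once a monomial multiplier has moved the leading exponent of [u] up to the
    next one congruent to [-1] modulo [p], [T] divides it by [p], rounding
    down in each variable. *)
Lemma trace_lowers_degree u : (1 < msize u)%N ->
  exists w, T (w * u) != 0 /\ (msize (T (w * u)) < msize u)%N.
Proof.
move=> su; have u0 : u != 0 by rewrite -msize_poly_eq0; lia.
pose m := mlead u; pose m' := [multinom (m i %/ p)%N | i < n].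
pose be := [multinom (p.-1 - m i %% p)%N | i < n].
have c0 : u@_m != 0 by rewrite mleadc_eq0.
have tm : top_digit p m' = (m + be)%MM.
  apply/mnmP => i; rewrite top_digitE // mnmDE !mnmE {2}(divn_eq (m i) p).
  have := ltn_pmod (m i) (ltnW p_gt1); lia.
have dm : (p * mdeg m' + n * p.-1 = mdeg m + mdeg be)%N.
  by rewrite -mdeg_top_digit // tm mdegD.
exists ((u@_m)^-1 *: 'X_[be]); set w := _ *: _.
have wu k : (w * u)@_k = if (be <= k)%MM then (u@_m)^-1 * u@_(k - be) else 0.
  rewrite /w -scalerAl mcoeffZ ['X_[be] * u]mulrC mcoeffMXif.
  by case: ifP => _; rewrite ?mulr0.
have Tm : (T (w * u))@_m' = 1.
  rewrite T_coef wu tm; have -> : (be <= m + be)%MM.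
    by apply/mnm_lepP => i; rewrite mnmDE leq_addl.
  by rewrite addmK mulVf.
have T1 : T (w * u) != 0.
  by apply: contraTneq isT => e; move/eqP: Tm; rewrite e mcoeff0 eq_sym oner_eq0.
split=> //; rewrite -(mlead_deg T1) -(mlead_deg u0) ltnS -/m.
set l := mlead _; have := mlead_supp T1; rewrite mcoeff_msupp T_coef wu -/l.
case: ifP => [/mnm_lepP bl hl|_]; last by rewrite (lam0 lamM) eqxx.
have [/msupp_le_mlead/lemc_mdeg hd|/memN_msupp_eq0 e] :=
    boolP ((top_digit p l - be)%MM \in msupp u); last first.
  by move: hl; rewrite e mulr0 (lam0 lamM) eqxx.
have : mdeg (top_digit p l) = (mdeg (top_digit p l - be) + mdeg be)%N.
  by rewrite -mdegD submK //; apply/mnm_lepP.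
rewrite mdeg_top_digit // => dl.
have m1 : (0 < mdeg m)%N by move: su; rewrite -(mlead_deg u0).
have : (p * mdeg m' <= mdeg m)%N.
  rewrite !mdegE big_distrr /=; apply: leq_sum => i _; rewrite mnmE mulnC.
  exact: leq_divM.
by move: hd; rewrite -/m; have := p_gt1; nia.
Qed.

(** If [f] is not in [P], then [f T u = T (f ^ p u)] makes [P] stable under
    [T] itself. As [T] lowers degrees, a nonzero element of least degree would
    be a constant. *)
Lemma compatible_prime_zero f P : prime_ideal P -> compatible f P -> ~ P f ->
  forall u, P u -> u = 0.
Proof.
move=> [P1 PM] comp Pf.
have PT u : P u -> P (T u).
  move=> Pu; have := comp _ (ideal_mull f Pu).
  by rewrite mulrA -exprSr pS T_frob => /PM[].
move=> u; have [N] := ubnP (msize u); elim: N u => // N IH u hN Pu.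
have [lt|ge] := ltnP 1 (msize u).
  have [w [w0 ws]] := trace_lowers_degree lt.
  case/eqP: w0; apply: IH; first exact: leq_trans ws _.
  exact: PT (ideal_mull w Pu).
have e := msize1_polyC ge; apply/eqP; apply: contraPT P1 => u0; apply.
have c0 : u@_0 != 0 by rewrite -(mpolyC_eq0 n) -e.
have -> : 1 = (u@_0)^-1%:MP * u by rewrite {2}e -mpolyCM mulVf // mpolyC1.
exact: ideal_mull.
Qed.

(** Multiplying by the monomial complementary to the leading one makes
    [x ^ (p - 1, ..., p - 1)] the only monomial of the product that [T] can
    see, because [f] has degree at most one in each variable. *)
Lemma trace_splits f : f != 0 -> multiaffine f -> exists w, T (w * f ^+ p.-1) = 1.
Proof.
move=> f0 aff; pose m := mlead f; pose c := f@_m.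
have c0 : c != 0 by rewrite mleadc_eq0.
pose be := [multinom (p.-1 * (1 - m i))%N | i < n].
have bound k i : k \in msupp (f ^+ p.-1) -> (k i <= p.-1)%N.
  move=> hk; rewrite -ltnS; apply: leq_trans (msupp_vsize i hk) _.
  elim: {hk} p.-1 => [|q IH].
    by rewrite expr0 -mpolyC1; have := unusedC i (1 : K); rewrite /uses -leqNgt.
  rewrite exprS vsizeM ?expf_neq0 //; have := aff i; lia.
have m1 i : (m i <= 1)%N.
  by have := msupp_vsize i (mlead_supp f0); have := aff i; rewrite -/m; lia.
exists ((c ^+ p.-1)^-1 *: 'X_[be]); apply/mpolyP => k.
rewrite T_coef -scalerAl mcoeffZ ['X_[be] * _]mulrC mcoeffMXif mcoeff1.
have [->|k0] := eqVneq k 0%MM.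
  have e : (top_digit p 0 - be)%MM = (m *+ p.-1)%MM.
    apply/mnmP => i; rewrite mnmBE top_digitE // mnm0E muln0 mnmE mulmnE.
    by have := m1 i; nia.
  have -> : (be <= top_digit p 0)%MM.
    by apply/mnm_lepP => i; rewrite top_digitE // mnmE; nia.
  by rewrite e mleadcX mulVf ?lam1 // expf_neq0.
have [i ki] : exists i, (0 < k i)%N.
  apply: contrapT => h; case/eqP: k0; apply/mnmP => i; rewrite mnm0E.
  by apply/eqP; rewrite -leqn0 leqNgt; apply/negP => hi; apply: h; exists i.
case: ifP => _; last by rewrite mulr0 (lam0 lamM).
rewrite memN_msupp_eq0 ?mulr0 ?(lam0 lamM) //; apply/negP => /(bound _ i).
rewrite mnmBE top_digitE // mnmE; have := p_gt1; nia.
Qed.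

End Compatible.

(** ** Compatible primes are generated by members of the family *)

Section CompatiblePrimes.
Variables (K : fieldType) (n p : nat) (charK : p \in [pchar K]).
Variable lam : K -> K.
Hypothesis lamD : forall x y, lam (x + y) = lam x + lam y.
Hypothesis lamM : forall a x, lam (a ^+ p * x) = a * lam x.
Hypothesis lam1 : lam 1 = 1.
Notation S := {mpoly K[n]}.
Notation compat := (@compatible K n p lam).
Implicit Types (a b f g h u v w : S) (i j z : 'I_n) (fs gs : seq S)
  (A P : ideal S).

Lemma no_common_factor a e z w0 w1 : irreducible_element a -> uses z a ->
  (vsize z a <= 2)%N -> irreducible_element e -> ~~ uses z e ->
  (as_poly z a)`_1 = w1 * e -> (as_poly z a)`_0 = w0 * e -> False.
Proof.
move=> [_ _ irra] za az [_ eu _] ze e1 e0.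
have ea : a = e * (w1 * 'X_z + w0).
  by rewrite {1}(affine_eval az) e1 e0; exact: factor_affine.
case: (irra _ _ ea) => [eU|]; first by case/negP: eu.
move=> /mpoly_unitP[k k0 ek]; case/negP: ze.
by rewrite -(usesZ z e k0) -mul_mpolyC mulrC -ek -ea.
Qed.

Lemma span_contains_vars fs u : affine_family fs -> ideal_span fs u -> u != 0 ->
  exists2 e, e \in fs & forall j, uses j e -> uses j u.
Proof.
move=> fam hu u0; apply: contrapT => h; case/eqP: u0.
apply: (span_vars fam hu) => a ha; apply: contrapT => h'; apply: h.
exists a; [exact: ha|move=> j ja]; apply: contrapT => /negP ju.
by apply: h'; exists j; rewrite ja ju.
Qed.

Lemma member_dvd_prod gs b : b \in gs -> exists w, \prod_(e <- gs) e = w * b.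
Proof.
by move=> hb; exists (\prod_(e <- rem b gs) e); rewrite (big_rem b hb) mulrC.
Qed.

Lemma span_same_vars fs e b : affine_family fs -> e \in fs -> multiaffine b ->
  ideal_span fs b -> (forall j, uses j b -> uses j e) -> exists w, b = w * e.
Proof.
move=> fam he baff hb sub; apply: span1.
have fame := family_perm (perm_to_rem he) fam.
apply: (span_dvd fame) => [|i|a ha|].
- exact: family_prime (family_headW fame).
- exact: baff.
- have [y ya] := irr_uses (family_irr (family_tail fame) ha).
  exists y; rewrite ya; apply: contraTN ya => /sub ye.
  exact: family_disjoint fame ha ye.
- apply: ideal_span_mono hb => c; rewrite (perm_mem (perm_to_rem he)); exact: id.
Qed.

Definition members P fs := [seq a <- fs | `[< P a >]].

Lemma mem_members P fs a : a \in members P fs -> P a /\ a \in fs.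
Proof. by rewrite mem_filter => /andP[/asboolP]. Qed.

Lemma members_in P fs a : P a -> a \in fs -> a \in members P fs.
Proof. by move=> h1 h2; rewrite mem_filter h2 andbT; exact/asboolP. Qed.

Lemma span_members P fs u : ideal_span (members P fs) u -> P u.
Proof. by apply: ideal_span_sub => a /mem_members[]. Qed.

(** Take a member [a = g z + h] in [P]. The contraction [P'] of [P] to the
    polynomials free of [z] is compatible with both families obtained by
    replacing [a] by the factors of [g] or by those of [h]; by induction,
    those of these factors and of the other members that lie in [P] generate
    [P'].

    If [g] is not in [P], then [P'] is generated by members, and as [g]
    cancels modulo the prime ideal generated by these and [a], pseudo-division
    by [a] determines [P].

    The case where [g], and so [h], lies in [P] does not occur. Both families
    generate [P'], and their members have disjoint variables. By [span_vars]
    the variables of a generator are those of an element of [P'] with a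
    minimal set of variables. So some factor [b] of [g] has the same variables
    as some factor [e] of [h], whence [e] divides [b], hence both [g] and [h],
    and [a] is not irreducible. *)
Theorem compatible_prime fs P : affine_family fs -> prime_ideal P ->
  compat (\prod_(a <- fs) a) P -> forall u, P u -> ideal_span (members P fs) u.
Proof.
have [N] := ubnP (var_count (\prod_(a <- fs) a)).
elim: N fs P => // N IH fs P hN fam prP comp u Pu.
have [Pf|Pf] := pselect (P (\prod_(a <- fs) a)); last first.
  rewrite (compatible_prime_zero charK lamD lamM lam1 prP comp Pf Pu).
  exact: (ideal0 (ideal_span _)).
have [a afs Pa] := prime_prod prP Pf.
have perm := perm_to_rem afs; set fs' := rem a fs in perm.
have {}fam := family_perm perm fam.
rewrite (perm_big _ perm) in hN comp.
have {}comp : compat (a * \prod_(b <- fs') b) P.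
  by move: comp; rewrite big_cons.
have airr : irreducible_element a by apply: family_irr fam _; exact: mem_head.
have [z za] := irr_uses airr.
have aff := family_head fam.
have zfs b : b \in fs' -> ~~ uses z b by move=> hb; exact: family_disjoint fam hb za.
have zF : ~~ uses z (\prod_(b <- fs') b).
  rewrite (uses_prod z (fun b hb => family_irr (family_tail fam) hb)).
  by apply/hasPn; exact: zfs.
pose P' := coef_ideal P z.
have prP' : prime_ideal P' by exact: coef_ideal_prime.
have g0 := slope_neq0 (aff z) za.
have [c [gs [c0 eg famg ug vlt]]] := coef_factor fam za g0.
have compg : compat (\prod_(b <- gs ++ fs') b) P'.
  apply: (compatibleZ c0); rewrite prod_cat scalerAl -eg.
  exact: (compatible_slope charK lamD lamM (aff z) zF comp).
have subg := IH (gs ++ fs') P' (leq_trans vlt hN) famg prP' compg.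
have freeg b : b \in gs ++ fs' -> ~~ uses z b.
  rewrite mem_cat => /orP[hb|]; last exact: zfs.
  by apply/negP => /(ug b hb)[_]; rewrite eqxx.
have gdvd b : b \in gs -> exists w, (as_poly z a)`_1 = w * b.
  move=> /member_dvd_prod[w ew]; exists (c *: w).
  by rewrite eg ew scalerAl.
have [Pg|Pg] := pselect (P (as_poly z a)`_1); last first.
  have [M [w [v [zv ev]]]] := pseudo_division u (aff z).
  have Pv : P v.
    rewrite -[v](addrK (w * a)) -ev.
    by apply: idealB; exact: ideal_mull.
  have sub' : {subset members P' (gs ++ fs') <= members P fs'}.
    move=> b /mem_members[P'b hb]; have Pb := coef_ideal_sub P'b.
    move: hb; rewrite mem_cat => /orP[/gdvd[x ex]|]; last exact: members_in.
    by case: Pg; rewrite ex; exact: ideal_mull.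
  have hv : ideal_span (members P fs') v.
    by apply: (ideal_span_mono sub'); apply: subg; exact/coef_ideal_unused.
  have fama : affine_family (a :: members P fs').
    have -> : a :: members P fs' = members P (a :: fs').
      by rewrite /members /= (asboolT Pa).
    exact: family_filter.
  have sub : {subset a :: members P fs' <= members P fs}.
    move=> b; rewrite inE => /orP[/eqP ->|/mem_members[Pb hb]].
      exact: members_in.
    by apply: members_in Pb _; rewrite (perm_mem perm) inE hb orbT.
  apply: (ideal_span_mono sub).
  have prime_a := family_prime fama.
  have : ideal_span (a :: members P fs') ((as_poly z a)`_1 ^+ M * u).
    rewrite ev; apply: idealD; last exact: ideal_span_head.
    exact: ideal_span_tail.
  case/prime_a.2 => [/(prime_exp prime_a) hg|]; last exact: id.
  case: Pg; apply: (@span_members P fs); exact: ideal_span_mono sub _ hg.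
have Ph : P (as_poly z a)`_0.
  rewrite -[_`_0](addKr ((as_poly z a)`_1 * 'X_z)) -(affine_eval (aff z)) addrC.
  by apply: idealB; [exact: Pa|exact: ideal_mulr].
have [b bgs Pb] : exists2 b, b \in gs & P b.
  by apply: (prime_prod prP); apply: (ideal_scale c0); rewrite -eg.
have birr : irreducible_element b.
  by apply: (family_irr famg); rewrite mem_cat bgs.
have [w1 ew1] := gdvd b bgs.
have zb : ~~ uses z b by apply: freeg; rewrite mem_cat bgs.
have [h0|h0] := eqVneq (as_poly z a)`_0 0.
  case: (no_common_factor (w0 := 0) airr za (aff z) birr zb ew1).
  by rewrite mul0r.
have [d [hs [d0 eh famh uh vlth]]] := coef_factor fam za h0.
have comph : compat (\prod_(e <- hs ++ fs') e) P'.
  apply: (compatibleZ d0); rewrite prod_cat scalerAl -eh.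
  exact: (compatible_const charK lamD lamM (aff z) zF comp).
have subh := IH (hs ++ fs') P' (leq_trans vlth hN) famh prP' comph.
have famL : affine_family (members P' (hs ++ fs')) by exact: family_filter.
have famL' : affine_family (members P' (gs ++ fs')) by exact: family_filter.
have hb : ideal_span (members P' (hs ++ fs')) b.
  by apply: subh; exact/coef_ideal_unused.
have outside e : irreducible_element e -> (forall j, uses j e -> uses j a) ->
    e \notin fs'.
  move=> eirr sub; have [y ye] := irr_uses eirr.
  by apply/negP => he; have := family_disjoint fam he (sub y ye); rewrite ye.
have [e eL ve] := span_contains_vars famL hb (irr_neq0 birr).
have eirr := family_irr famL eL.
have [P'e ehs] : P' e /\ e \in hs.
  have [P'e] := mem_members eL; rewrite mem_cat => /orP[//|efs].
  case/negP: (outside e eirr (fun j je => (ug b bgs j (ve j je)).1)).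
  exact: efs.
have ze : ~~ uses z e by apply/negP => /(uh e ehs)[_]; rewrite eqxx.
have he : ideal_span (members P' (gs ++ fs')) e by exact: subg.
have [b' bL' vb'] := span_contains_vars famL' he (irr_neq0 eirr).
have b'irr := family_irr famL' bL'.
have [_ b'gf] := mem_members bL'.
have eb : b' = b.
  have [y yb'] := irr_uses b'irr; apply/eqP; apply: contraTT yb' => nb.
  have yrem : b' \in rem b (gs ++ fs') by apply: rem_mem.
  have bgf : b \in gs ++ fs' by rewrite mem_cat bgs.
  apply/negP => yb'; have := family_shared famg bgf yrem (ve y (vb' y yb')).
  by rewrite yb'.
have [w ew] : exists w, b = w * e.
  apply: (span_same_vars famL eL _ hb) => [i|j jb].
    by apply: (@family_head _ _ b fs'); exact: family_pick famg bgs.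
  by apply: vb'; rewrite eb.
have [w0 ew0] := member_dvd_prod ehs.
have e1 : (as_poly z a)`_1 = (w1 * w) * e by rewrite ew1 ew mulrA.
case: (no_common_factor (w0 := d *: w0) airr za (aff z) eirr ze e1).
by rewrite eh ew0 scalerAl.
Qed.

End CompatiblePrimes.

(** * Noetherianity *)

(** Only the first [k] coordinates are compared. In the induction on [k], the
    finite set for [k] serves for all exponents whose next coordinate is at
    least the bound [N]; each of the finitely many smaller values of that
    coordinate gets a finite set of its own. *)
Lemma dickson n (A : set 'X_{1..n}) k : exists B : seq 'X_{1..n},
  (forall b, b \in B -> A b) /\
  forall a, A a -> exists2 b, b \in B & forall i : 'I_n, (i < k)%N -> (b i <= a i)%N.
Proof.
elim: k A => [|k IH] A.
  have [[a0 Aa0]|h] := pselect (exists a, A a).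
    exists [:: a0]; split=> [b|a _]; first by rewrite inE => /eqP ->.
    by exists a0; rewrite ?inE.
  by exists [::]; split=> // a Aa; case: h; exists a.
have [B0 [B0A B0le]] := IH A.
have [kn|nk] := ltnP k n; last first.
  exists B0; split=> // a /B0le[b bB ba]; exists b => // i _; apply: ba.
  exact: leq_trans (ltn_ord i) nk.
pose x := Ordinal kn; pose N := \max_(b <- B0) b x.
have [f hf] := choice (fun j : nat => IH (fun a => A a /\ a x = j)).
exists (B0 ++ flatten [seq f j | j <- iota 0 N]); split=> [b|a Aa].
  rewrite mem_cat => /orP[/B0A //|/flatten_mapP[j _]].
  by case: (hf j) => h _ /h[].
have [ge|lt] := leqP N (a x).
  have [b bB ba] := B0le a Aa; exists b; first by rewrite mem_cat bB.
  move=> i; rewrite ltnS leq_eqVlt => /orP[/eqP ik|]; last exact: ba.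
  have -> : i = x by apply: val_inj.
  apply: leq_trans ge; rewrite /N (big_rem b bB) /=; exact: leq_maxl.
have [_ /(_ a (conj Aa erefl))[b bB ba]] := hf (a x).
exists b; first rewrite mem_cat; first apply/orP; first right.
  by apply/flatten_mapP; exists (a x) => //; rewrite mem_iota.
move=> i; rewrite ltnS leq_eqVlt => /orP[/eqP ik|]; last exact: ba.
have -> : i = x by apply: val_inj.
by case: (hf (a x)) => /(_ b bB)[_ ->].
Qed.

(** Dickson's lemma yields finitely many elements of the ideal whose leading
    monomials divide those of all the others, and division by these stays in
    the ideal. *)
Lemma mpoly_noetherian (K : fieldType) n : noetherian {mpoly K[n]}.
Proof.
move=> I; pose A m := exists u, [/\ I u, u != 0 & mlead u = m].
have [B [BA Ble]] := dickson A n.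
have witness m : exists v, A m -> [/\ I v, v != 0 & mlead v = m].
  by have [[u hu]|h] := pselect (A m); [exists u|exists 0 => /h].
have [U hU] := choice witness.
exists [seq U b | b <- B]; apply/predeqP => u; split; last first.
  by apply: ideal_span_sub => _ /mapP[b /BA/hU[Ub _ _] ->].
elim/mleadrect: u => u IH Iu.
have [->|u0] := eqVneq u 0; first exact: (ideal0 (ideal_span _)).
have [b bB ble] : exists2 b, b \in B & forall i : 'I_n, (i < n)%N -> (b i <= mlead u i)%N.
  by apply: Ble; exists u.
have [Ub Ub0 lb] := hU b (BA b bB).
have bu : (b <= mlead u)%MM by apply/mnm_lepP => i; exact: ble (ltn_ord i).
have c0 : u@_(mlead u) != 0 by rewrite mleadc_eq0.
have d0 : (U b)@_b != 0 by have := mleadc_eq0 (U b); rewrite lb => ->.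
pose q := (u@_(mlead u) / (U b)@_b) *: 'X_[mlead u - b].
have q0 : u@_(mlead u) / (U b)@_b != 0 by rewrite mulf_neq0 ?invr_eq0.
have X0 : 'X_[mlead u - b] != 0 :> {mpoly K[n]} by rewrite -msize_poly_eq0 msizeX.
have qn0 : q != 0 by rewrite mscalerI negb_or q0.
have lq : mlead q = (mlead u - b)%MM by rewrite mleadZ // mleadXm.
have ql : mlead (q * U b) = mlead u by rewrite mleadM // lq lb submK.
have qc : (q * U b)@_(mlead u) = u@_(mlead u).
  rewrite -{1}ql mleadM // mleadcM lq lb mcoeffZ mcoeffX eqxx mulr1.
  by rewrite divfK.
have spanq : ideal_span [seq U b | b <- B] (q * U b).
  by apply: ideal_mull; apply: ideal_span_mem; exact: map_f.
apply: (ideal_subl _ spanq); set v := u - q * U b.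
have [->|v0] := eqVneq v 0; first exact: (ideal0 (ideal_span _)).
apply: IH; last by apply: idealB Iu _; exact: ideal_mull.
rewrite Order.POrderTheory.lt_neqAle; apply/andP; split.
  apply: contraNneq v0 => e; rewrite -mleadc_eq0 e mcoeffB qc subrr.
  exact: eqxx.
have := mleadB_le u (q * U b); rewrite ql Order.JoinTheory.joinxx.
exact: id.
Qed.

(** * Frobenius powers and quotients *)

Section FrobeniusPowers.
Variables (R : comPzRingType) (p : nat).
Implicit Types (I J P A : ideal R) (c f s w x y : R).

Lemma frobenius_power_mem e I x : I x -> frobenius_power p e I (x ^+ (p ^ e)).
Proof. by move=> Ix A; apply; exists x. Qed.

Lemma frobenius_power_sub e I A : (forall x, I x -> A (x ^+ (p ^ e))) ->
  forall y, frobenius_power p e I y -> A y.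
Proof. by move=> h y; apply => _ [x Ix <-]; exact: h. Qed.

Lemma frobenius_power0 I y : frobenius_power p 0 I y -> I y.
Proof. by apply: frobenius_power_sub => x; rewrite expn0 expr1. Qed.

Section Inverse.
Variable T : R -> R.
Hypothesis TD : forall x y, T (x + y) = T x + T y.
Hypothesis TM : forall c x, T (c ^+ p * x) = c * T x.

(** [T] undoes one Frobenius: [T (w (x ^ q) ^ p) = x ^ q T w]. *)
Lemma inverse_frobenius_power e I y :
  frobenius_power p e.+1 I y -> frobenius_power p e I (T y).
Proof.
have T0 : T 0 = 0 by apply: (@addrI _ (T 0)); rewrite -TD !addr0.
have z : is_ideal (fun y => forall w, frobenius_power p e I (T (w * y))).
  split=> [w|x x' hx hx' w|a x hx w].
  - by rewrite mulr0 T0; exact: (ideal0 (frobenius_power p e I)).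
  - by rewrite mulrDr TD; exact: (idealD (I := frobenius_power p e I)).
  - by rewrite mulrA.
move=> hy; suff : Ideal z y by move=> /(_ 1); rewrite mul1r.
move: hy; apply: frobenius_power_sub.
move=> x Ix w; rewrite expnSr exprM mulrC TM mulrC.
by apply: ideal_mull; exact: frobenius_power_mem.
Qed.

(** A maximal proper [T]-stable ideal [P] is prime: for [c] outside [P], the
    ideal [(P : c)] is again proper, and it is [T]-stable because
    [c T x = T (c ^ p x)]; so it equals [P]. *)
Lemma stable_prime (Q : ideal R) : (0 < p)%N -> ~ Q 1 ->
  (forall x, Q x -> Q (T x)) -> exists P, [/\ prime_ideal P,
    forall x, P x -> P (T x) & forall x, Q x -> P x].
Proof.
move=> p0 Q1 QT.
pose good A := [/\ ~ A 1, forall x, A x -> A (T x) & forall x, Q x -> A x].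
(* [Q] is adjoined to [W], so that the union of the empty chain qualifies. *)
pose G (W : set R) := exists2 A, good A & forall x, A x <-> W x \/ Q x.
have [W [[P [P1 PT QP] PW] max]] : exists W, G W /\ forall B, (W `<` B)%classic -> ~ G B.
  apply: Zorn_bigcup => F FG tot.
  pose V x := (\bigcup_(X in F) X)%classic x \/ Q x.
  have goodQ : good Q by [].
  have piece x : V x -> exists B, [/\ good B, B x, forall y, B y -> V y &
      B = Q \/ exists2 X, F X & forall y, B y <-> X y \/ Q y].
    move=> [[X FX Xx]|Qx].
      have [A gA AX] := FG X FX; exists A; split=> //.
      - by apply/AX; left.
      - by move=> y /AX[Xy|]; [left; exists X|right].
      - by right; exists X.
    by exists Q; split=> //; [move=> y; right|left].
  have pair x y : V x -> V y -> exists B, [/\ good B, B x, B y & forall z, B z -> V z].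
    move=> /piece[B [gB Bx BV HB]] /piece[C [gC Cy CV HC]].
    have [BC|CB] : (forall z, B z -> C z) \/ (forall z, C z -> B z).
      case: HB => [->|[X FX BX]]; first by left; case: gC.
      case: HC => [->|[Y FY CY]]; first by right; case: gB.
      have [XY|YX] := tot _ _ FX FY.
        by left=> z /BX[/XY|] h; apply/CY; [left|right].
      by right=> z /CY[/YX|] h; apply/BX; [left|right].
    - by exists C; split=> //; exact: BC.
    - by exists B; split=> //; exact: CB.
  have Vid : is_ideal V.
    split=> [|x y hx hy|a x hx].
    - by right; exact: ideal0.
    - by have [B [_ Bx By BV]] := pair x y hx hy; apply: BV; exact: idealD.
    - by have [B [_ Bx _ BV]] := pair x x hx hx; apply: BV; exact: ideal_mull.
  exists (Ideal Vid) => //; split=> /= [h|x hx|x]; last by right.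
    by have [B [[B1 _ _] Bx _ BV]] := pair _ _ h h.
  by have [B [[_ BT _] Bx _ BV]] := pair x x hx hx; apply: BV; exact: BT.
exists P; split=> //; split=> // x y Pxy.
apply: contrapT => /not_orP[Px Py].
have gC : good (colon P y).
  split=> /= [|z hz|z /QP hz]; first by rewrite mul1r.
    rewrite mulrC -TM; apply: PT; rewrite mulrC.
    by case: p p0 => // q _; rewrite exprS mulrA; exact: ideal_mulr.
  exact: ideal_mulr.
apply: (max (fun z => P (z * y))).
  split=> [z Wz /=|h]; first by apply: ideal_mulr; apply/PW; left.
  have /h Wx : P (x * y) by [].
  by apply: Px; apply/PW; left.
exists (colon P y) => // z; split=> /= [|[//|/QP]]; first by left.
exact: ideal_mulr.
Qed.

End Inverse.

Lemma to_quot_surj J (x : quot_ring J) : exists s, x = to_quot J s.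
Proof. by exists (repr x); rewrite /to_quot reprK. Qed.

Lemma to_quot_eq0 J a : to_quot J a = 0 <-> J a.
Proof. by rewrite -(rmorph0 (to_quot J)) to_quot_eq subr0. Qed.

Lemma quot_neq0 J : prime_ideal J -> (1 : quot_ring J) <> 0.
Proof. by move=> [J1 _]; rewrite -(rmorph1 (to_quot J)) => /to_quot_eq0. Qed.

Lemma quot_zero_prime J : prime_ideal J -> prime_ideal (zero_ideal (quot_ring J)).
Proof.
move=> prJ; split=> [|x y]; first exact: quot_neq0.
have [[a ->] [b ->]] := (to_quot_surj x, to_quot_surj y).
rewrite /= -rmorphM => /to_quot_eq0/prJ.2.
by case=> h; [left|right]; exact/to_quot_eq0.
Qed.

Lemma quot_noetherian J : noetherian R -> noetherian (quot_ring J).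
Proof.
move=> nR I; have [rs ers] := nR (preim_ideal (to_quot J) I).
exists [seq to_quot J r | r <- rs]; apply/predeqP => x; split; last first.
  apply: ideal_span_sub => _ /mapP[r hr ->].
  have : ideal_span rs r by exact: ideal_span_mem.
  by rewrite -ers.
have [s ->] := to_quot_surj x => Is.
have : ideal_span rs s by rewrite -ers.
suff : forall y, ideal_span rs y ->
    preim_ideal (to_quot J) (ideal_span [seq to_quot J r | r <- rs]) y by apply.
by apply: ideal_span_sub => r hr /=; apply: ideal_span_mem; exact: map_f.
Qed.

(** Two representatives of a class differ by an element of [J], which [F]
    absorbs. So the classes all of whose representatives are multiplied by [F]
    into the Frobenius power form an ideal, and it contains the generators
    [x ^ q] of the Frobenius power of [I]. *)
Lemma frobenius_power_lift J (I : ideal (quot_ring J)) e F :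
  (forall a, J a -> frobenius_power p e (preim_ideal (to_quot J) I) (F * a)) ->
  forall v, frobenius_power p e I (to_quot J v) ->
  frobenius_power p e (preim_ideal (to_quot J) I) (F * v).
Proof.
set A := frobenius_power p e _ => JA.
have lift v y : to_quot J v = to_quot J y -> A (F * y) -> A (F * v).
  by move=> /to_quot_eq /JA h; apply: ideal_subl; rewrite -mulrBr.
have z : is_ideal (fun y : quot_ring J => forall v, to_quot J v = y -> A (F * v)).
  split=> [v e0|x y hx hy v ev|a x hx v ev].
  - by apply: (lift v 0); rewrite ?rmorph0 // mulr0; exact: ideal0.
  - have [s es] := to_quot_surj x.
    rewrite -[v](subrK s) mulrDr; apply: idealD; last exact: hx.
    by apply: hy; rewrite rmorphB /= ev -es addrC addKr.
  - have [b eb] := to_quot_surj a; have [s es] := to_quot_surj x.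
    apply: (lift v (b * s)); first by rewrite rmorphM /= ev -eb -es.
    by rewrite mulrCA; apply: ideal_mull; exact: hx.
move=> v hv; suff : Ideal z (to_quot J v) by apply.
apply: (hv (Ideal z)) => _ [x Ix <-] w ew.
have [s es] := to_quot_surj x; apply: (lift w (s ^+ (p ^ e))).
  by rewrite rmorphXn /= -es.
by apply: ideal_mull; apply: frobenius_power_mem; rewrite /= -es.
Qed.

End FrobeniusPowers.

(** * F-rationality *)

Section TightClosure.
Variables (K : fieldType) (n p : nat) (charK : p \in [pchar K]).
Notation S := {mpoly K[n]}.
Implicit Types (a d f r w : S) (fs : seq S) (I J : ideal S).

(** As [f ^ (q - 1)] multiplies each factor of [f] into its [q]-th power, a
    tight closure relation modulo the factors of [f] puts its multiplier into
    this ideal. *)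
Lemma multiplier_is_ideal f r I e0 : is_ideal (fun c : S => forall e, (e0 <= e)%N ->
  frobenius_power p e I (c * (f ^+ (p ^ e).-1 * r ^+ (p ^ e)))).
Proof.
split=> [e _|x y hx hy e he|b x hx e he].
- by rewrite mul0r; exact: ideal0.
- by rewrite mulrDl; apply: idealD; [exact: hx|exact: hy].
- by rewrite -mulrA; apply: ideal_mull; exact: hx.
Qed.

Definition multiplier f r I e0 : ideal S := Ideal (multiplier_is_ideal f r I e0).

(** The multipliers form an ideal stable under [c |-> T (f ^ (p - 1) c)]. If it
    contained [1], splitting Frobenius repeatedly would bring
    [f ^ (q - 1) r ^ q] in [I ^ [q]] down to [r] in [I]. Otherwise it lies in
    a stable prime, hence in the ideal of the family. *)
Lemma family_tight_closure fs I d r e0 : affine_family fs ->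
  (forall e, (e0 <= e)%N -> frobenius_power p e I
     (d * ((\prod_(a <- fs) a) ^+ (p ^ e).-1 * r ^+ (p ^ e)))) ->
  ~ ideal_span fs d -> I r.
Proof.
move=> fam hd dJ; apply: contrapT => Ir; apply: dJ.
have [lam [lamD lamM lam1]] := frobenius_splitting charK.
have p0 : (0 < p)%N by case/andP: charK => /prime_gt0.
have pS : p.-1.+1 = p by rewrite prednK.
have TD (u v : S) := traceD charK lamD lamM u v.
have TM (u v : S) := trace_frobenius charK lamD lamM u v.
set f := \prod_(a <- fs) a in hd.
have f0 : f != 0 by exact: prod_irr_neq0 fam.1.
(* With [q = p ^ e], this is [p q - 1 = p (q - 1) + (p - 1)]. *)
have step e : f ^+ (p ^ e.+1).-1 * r ^+ (p ^ e.+1) =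
    (f ^+ (p ^ e).-1 * r ^+ (p ^ e)) ^+ p * f ^+ p.-1.
  have q0 : (0 < p ^ e)%N by rewrite expn_gt0 p0.
  rewrite exprMn -!exprM -expnSr mulrAC -exprD; congr (f ^+ _ * _).
  by rewrite expnSr; nia.
have [w hw] := trace_splits charK lamM lam1 f0 fam.2.
pose Q := multiplier f r I e0.
have Q1 : ~ Q 1.
  move=> /(_ e0 (leqnn _)); rewrite mul1r => h; apply: Ir.
  elim: e0 {hd Q} h => [|e IH] h.
    by have := frobenius_power0 h; rewrite expn0 expr0 expr1 mul1r.
  apply: IH; have := inverse_frobenius_power TD TM (ideal_mull w h).
  rewrite step mulrCA TM hw mulr1; exact: id.
have QT c : Q c -> Q (trace p lam (f ^+ p.-1 * c)).
  move=> hc e he; have := hc e.+1 (leqW he); rewrite step => h.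
  have := inverse_frobenius_power TD TM h.
  by rewrite mulrCA TM [c * _]mulrC [_ * trace _ _ _]mulrC; exact: id.
pose T' c := trace p lam (f ^+ p.-1 * c).
have TM' c x : T' (c ^+ p * x) = c * T' x by rewrite /T' mulrCA TM.
have [P [prP PT QP]] := stable_prime TM' p0 Q1 QT.
have Pd : P d by apply: QP => e he; exact: hd.
apply: ideal_span_mono (compatible_prime charK lamD lamM lam1 fam prP PT Pd).
by move=> b /mem_members[].
Qed.

End TightClosure.

Theorem theorem2 (p : nat) (K : fieldType) (charK : p \in [pchar K])
    (n : nat) (f : {mpoly K[n]}) (sqf : square_free_supported f)
    (t : nat) (f_ : 'I_t -> {mpoly K[n]})
    (irr : forall i : 'I_t, irreducible_element (f_ i))
    (factf : f = \prod_(i < t) f_ i) :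
  F_rational (quot_ring (ideal_span (codom f_))) p.
Proof.
set J := ideal_span (codom f_).
have ef : f = \prod_(a <- codom f_) a.
  by rewrite factf codomE big_map big_enum.
have fam : affine_family (codom f_).
  split; first by move=> _ /codomP[i ->]; exact: irr.
  by rewrite -ef; exact: square_free_multiaffine.
have prJ : prime_ideal J := family_prime fam.
have p0 : (0 < p)%N by case/andP: charK => /prime_gt0.
split.
- exact/quot_noetherian/mpoly_noetherian.
- case/andP: (charK) => pp /eqP pK; split.
  + exact: quot_neq0.
  + exact: pp.
  + rewrite -(rmorph_nat (to_quot J)) -mpolyC_nat pK mpolyC0; exact: rmorph0.
move=> I _; apply/predeqP => x; split; last first.
  move=> Ix; exists 1; first by move=> P [[P1 _] _].
  by exists 0%N => e _; rewrite mul1r; exact: frobenius_power_mem.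
have [r ->] := to_quot_surj x; move=> [c cmin [e0 he]].
have [d ed] := to_quot_surj c; rewrite ed in cmin he.
have JI a : a \in codom f_ -> preim_ideal (to_quot J) I a.
  move=> /ideal_span_mem /to_quot_eq0 a0; rewrite /= a0; exact: ideal0.
have frob e a : J a -> frobenius_power p e (preim_ideal (to_quot J) I)
    (f ^+ (p ^ e).-1 * a).
  set A := frobenius_power _ _ _; rewrite mulrC; move: a.
  apply: (ideal_span_sub (J := colon A _)) => a ha.
  have [w ew] := member_dvd_prod ha.
  rewrite -[colon _ _ _]/(A (a * f ^+ (p ^ e).-1)) ef ew exprMn mulrCA -exprS.
  rewrite prednK ?expn_gt0 ?p0 //.
  by apply: ideal_mull; apply: frobenius_power_mem; exact: JI.
apply: (family_tight_closure charK fam (I := preim_ideal (to_quot J) I) (d := d) (e0 := e0)).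
- move=> e hee; rewrite -ef mulrCA; apply: frobenius_power_lift; first exact: frob.
  by rewrite rmorphM rmorphXn; exact: he.
- move=> Jd; apply: (cmin _ (zero_minimal_prime (quot_zero_prime prJ))).
  exact/to_quot_eq0.
Qed.
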